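(* Let $(X,G)$ be a minimal topological dynamical system, where $G$ is amenable, and assume $(X,G)$ satisfies the local Bronstein condition. Then: (i) There exists a dense $G_\delta$ subset $Z\subset X_{eq}$ with $\nu_{eq}(Z)=1$ such that $\pi_{eq}^{-1}(y)$ is a weakly mean-sensitive set for every $y\in Z$. (ii) If $K\in\mathbb N$ and $\pi_{eq}$ is regular $K$ to one, then $(X,G)$ has essential weakly mean-sensitive $K$-tuples but has no essential weakly mean-sensitive $(K+1)$-tuples. (iii) Every weakly mean-sensitive set is an IT-set.
   Context: $G$ is an infinite countable discrete group. A tds $(X,G)$ is a compact metric space $(X,d)$ with a $G$-action by homeomorphisms; minimal means no proper nonempty closed invariant subset; a minimal point is one whose orbit closure is minimal. $\pi_{eq}:X\to X_{eq}$ is the factor map onto the maximal equicontinuous factor; for minimal $(X,G)$, $(X_{eq},G)$ is uniquely ergodic with invariant measure $\nu_{eq}$. $\pi_{eq}$ is regular $K$ to one if $\nu_{eq}(\{y:|\pi_{eq}^{-1}(y)|=K\})=1$. $RP_2(X,G)$ is the set of $(x_1,x_2)$ such that for every $\epsilon>0$ there are $x_1',x_2'$ and $g\in G$ with $d(x_k,x_k')\le\epsilon$ and $d(gx_1',gx_2')\le\epsilon$. Local Bronstein condition: whenever $(x,x')\in RP_2(X,G)$ is a minimal point of $(X\times X,G)$, there exist minimal points $(x_n,x_n')$ of $(X\times X,G)$ and $g_n\in G$ with $(x_n,x_n')\to(x,x')$ and $d(g_nx_n,g_nx_n')\to0$. For $F\subset G$ with $G$ amenable, $\overline{BD}(F)=\max_{\{F_n\}}\limsup_n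 |F_n\cap F|/|F_n|$ over all Følner sequences $\{F_n\}$ of $G$. A tuple $(x_1,\dots,x_K)\in X^K$ is a weakly mean-sensitive $K$-tuple if for all open neighborhoods $U_k$ of $x_k$ there is $\delta>0$ such that for every nonempty open $U\subset X$, $\overline{BD}(\{g\in G: gU\cap U_k\neq\emptyset \text{ for } 1\le k\le K\})>\delta$. It is essential if its entries are pairwise distinct. A weakly mean-sensitive set is a set such that every tuple of its points is weakly mean-sensitive. Independence set for $(A_1,\dots,A_K)$: $J\subset G$ with $\bigcap_{g\in I}g^{-1}A_{\sigma(g)}\neq\emptyset$ for all nonempty finite $I\subset J$ and $\sigma:I\to\{1,\dots,K\}$. A $K$-IT-tuple is $(x_1,\dots,x_K)$ such that for all open neighborhoods $U_k\ni x_k$, $(U_1,\dots,U_K)$ has an infinite independence set; an IT-set is a nonempty set all of whose tuples are IT-tuples. *)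

(* Defs.v *)
From HB Require Import structures.
From mathcomp Require Import all_boot all_order all_algebra.
From mathcomp Require Import monoid.
From mathcomp Require Import all_classical all_reals all_analysis.

Set Implicit Arguments.
Unset Strict Implicit.
Unset Printing Implicit Defensive.

Import Order.TTheory GRing.Theory Num.Theory numFieldNormedType.Exports.
Local Open Scope classical_set_scope.
Local Open Scope ring_scope.

Definition is_metric {R : realType} {X : Type} (d : X -> X -> R) : Prop :=
  (forall x y, 0 <= d x y) /\ (forall x y, d x y = 0 <-> x = y) /\
  (forall x y, d x y = d y x) /\ (forall x y z, d x z <= d x y + d y z).

Definition metric_induces_topology {R : realType} {X : topologicalType}
  (d : X -> X -> R) : Prop :=
  forall A : set X, open A <->
    (forall x, A x -> exists2 e : R, 0 < e & [set y | d x y < e] `<=` A).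

Definition compact_metric_space {R : realType} {X : topologicalType}
  (d : X -> X -> R) : Prop :=
  is_metric d /\ metric_induces_topology d /\ compact [set: X].

Definition is_action {G : groupType} {X : topologicalType} (act : G -> X -> X)
  : Prop :=
  (forall x, act (1%g : G) x = x) /\
  (forall (g h : G) x, act (g * h)%g x = act g (act h x)) /\
  (forall g, continuous (act g)).

Definition invariant_set {G : groupType} {X : Type} (act : G -> X -> X)
  (A : set X) : Prop := forall g x, A x -> A (act g x).

Definition minimal_system {G : groupType} {X : topologicalType}
  (act : G -> X -> X) : Prop :=
  forall A : set X, closed A -> A !=set0 -> invariant_set act A -> A = setT.

Definition orbit_closure {G : groupType} {X : topologicalType}
  (act : G -> X -> X) (x : X) : set X := closure (range (fun g => act g x)).

Definition minimal_point {G : groupType} {X : topologicalType}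
  (act : G -> X -> X) (x : X) : Prop :=
  forall A : set X, closed A -> A !=set0 -> A `<=` orbit_closure act x ->
    invariant_set act A -> A = orbit_closure act x.

Definition pair_act {G : groupType} {X : Type} (act : G -> X -> X)
  (g : G) (p : X * X) : X * X := (act g p.1, act g p.2).

Definition RP2 {R : realType} {G : groupType} {X : Type} (d : X -> X -> R)
  (act : G -> X -> X) (x1 x2 : X) : Prop :=
  forall e : R, 0 < e -> exists x1' x2' (g : G),
    d x1 x1' <= e /\ d x2 x2' <= e /\ d (act g x1') (act g x2') <= e.

Definition local_Bronstein {R : realType} {G : groupType} {X : topologicalType}
  (d : X -> X -> R) (act : G -> X -> X) : Prop :=
  forall x x' : X, RP2 d act x x' -> minimal_point (pair_act act) (x, x') ->
    exists (u : nat -> X * X) (gs : nat -> G),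
      (forall n, minimal_point (pair_act act) (u n)) /\
      u @ \oo --> (x, x') /\
      (fun n => d (act (gs n) (u n).1) (act (gs n) (u n).2)) @ \oo --> (0 : R).

Definition equicontinuous_system {R : realType} {G : groupType} {Y : Type}
  (dY : Y -> Y -> R) (actY : G -> Y -> Y) : Prop :=
  forall e : R, 0 < e -> exists2 dl : R, 0 < dl &
    forall y y', dY y y' < dl -> forall g, dY (actY g y) (actY g y') < e.

Definition factor_map {G : groupType} {X Y : topologicalType}
  (actX : G -> X -> X) (actY : G -> Y -> Y) (pi : X -> Y) : Prop :=
  continuous pi /\ (forall y, exists x, pi x = y) /\
  (forall g x, pi (actX g x) = actY g (pi x)).

Definition max_equicontinuous_factor {R : realType} {G : groupType}
  {X Y : topologicalType} (actX : G -> X -> X) (dY : Y -> Y -> R)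
  (actY : G -> Y -> Y) (pi : X -> Y) : Prop :=
  compact_metric_space dY /\ is_action actY /\ equicontinuous_system dY actY /\
  factor_map actX actY pi /\
  forall (Z : topologicalType) (dZ : Z -> Z -> R) (actZ : G -> Z -> Z)
         (rho : X -> Z),
    compact_metric_space dZ -> is_action actZ ->
    equicontinuous_system dZ actZ -> factor_map actX actZ rho ->
    exists phi : Y -> Z, factor_map actY actZ phi /\ forall x, rho x = phi (pi x).

Notation borel_type Y := (g_sigma_algebraType (@open Y)).

(* number of elements of the symmetric difference of two duplicate-free lists *)
Definition symdiff_size {G : eqType} (s t : seq G) : nat :=
  count (fun x => x \notin t) s + count (fun x => x \notin s) t.

Definition Folner_seq {R : realType} {G : groupType} (F : nat -> seq G) : Prop :=
  (forall n, uniq (F n) /\ F n != [::]) /\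
  forall g : G,
    (fun n => ((symdiff_size (map (fun h => (g * h)%g) (F n)) (F n))%:R
               / (size (F n))%:R : R)) @ \oo --> (0 : R).

Definition amenable_group (R : realType) (G : groupType) : Prop :=
  exists F : nat -> seq G, Folner_seq (R := R) F.

Definition upper_BD {R : realType} {G : groupType} (A : set G) : \bar R :=
  ereal_sup [set l : \bar R | exists F : nat -> seq G, Folner_seq (R := R) F /\
     l = limn_esup (fun n => (((count (fun g => `[< A g >]) (F n))%:R
                               / (size (F n))%:R : R)%:E))].

Definition wms_tuple {R : realType} {G : groupType} {X : topologicalType}
  (act : G -> X -> X) (K : nat) (xs : 'I_K -> X) : Prop :=
  forall U : 'I_K -> set X, (forall k, open (U k) /\ U k (xs k)) ->
    exists2 dl : R, 0 < dl &
      forall V : set X, open V -> V !=set0 ->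
        (dl%:E < upper_BD [set g : G | forall k, (act g @` V) `&` U k !=set0])%E.

Definition wms_set {R : realType} {G : groupType} {X : topologicalType}
  (act : G -> X -> X) (A : set X) : Prop :=
  forall (K : nat) (xs : 'I_K -> X), (forall k, A (xs k)) ->
    wms_tuple (R := R) act xs.

Definition independence_set {G : groupType} {X : Type} (act : G -> X -> X)
  (K : nat) (As : 'I_K -> set X) (J : set G) : Prop :=
  forall (I : seq G) (sigma : G -> 'I_K), I != [::] ->
    (forall g, g \in I -> J g) ->
    exists x : X, forall g, g \in I -> As (sigma g) (act g x).

Definition IT_tuple {G : groupType} {X : topologicalType} (act : G -> X -> X)
  (K : nat) (xs : 'I_K -> X) : Prop :=
  forall U : 'I_K -> set X, (forall k, open (U k) /\ U k (xs k)) ->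
    exists J : set G, infinite_set J /\ independence_set act U J.

Definition IT_set {G : groupType} {X : topologicalType} (act : G -> X -> X)
  (A : set X) : Prop :=
  A !=set0 /\
  forall (K : nat) (xs : 'I_K -> X), (forall k, A (xs k)) -> IT_tuple act xs.

Definition G_delta {Y : topologicalType} (Z : set Y) : Prop :=
  exists U : nat -> set Y, (forall n, open (U n)) /\ Z = \bigcap_n U n.

Definition regular_K_to_one {R : realType} {X : topologicalType} {Y : ptopologicalType}
  (pi : X -> Y) (nu : probability (borel_type Y) R) (K : nat) : Prop :=
  let S := [set y : Y | (pi @^-1` [set y] #= `I_K)%card] in
  measurable (S : set (borel_type Y)) /\ nu S = 1%E.

(* Main.v *)
Require Import Defs.
From HB Require Import structures.
From mathcomp Require Import all_boot all_order all_algebra.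
From mathcomp Require Import monoid.
From mathcomp Require Import all_classical all_reals all_analysis.
From mathcomp Require Import measurable_realfun lra.
Import Order.TTheory GRing.Theory Num.Theory numFieldNormedType.Exports.
Local Open Scope classical_set_scope.
Local Open Scope ring_scope.

Set Implicit Arguments.
Unset Strict Implicit.
Unset Printing Implicit Defensive.

(** An invariant mean on [G] carries McMahon's argument: for a closed invariant
    set [Q] of tuples, the measure of the symmetric difference of two sections
    of [Q] is a continuous invariant pseudometric on [X], so it vanishes on the
    fibres of [pi].  Hence the closure of the orbit of a box [W_1 x ... x W_n]
    contains every tuple over the product of the interiors of the [pi W_i].

    For (i), a closed set [D] of positive measure in [Y] is visited often by some
    [y] along any given finite subset of [G]; the previous fact transfers these
    visits to an arbitrary open set [V] through a translation.  The set [Z] is the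
    complement of the null sets among the [D = \bigcap_k pi (closure (b_k))], the
    [b_k] running over a countable base.

    Conversely, unique ergodicity of [Y] bounds the density of the visits of a
    point to a closed set by its measure, so neighbourhoods [U_k] of the points of a
    weakly mean-sensitive tuple satisfy [nu (\bigcap_k pi (closure (U_k))) > 0].
    This rules out [K+1] distinct points in (ii).  In (iii) an infinite independence
    set is built by induction, keeping one base point for each branch so that the
    translations bringing all base points close to [D] have positive mean. *)

(** * Metric topology and minimal actions *)

Definition mball {R : realType} {X : Type} (d : X -> X -> R) (x : X) (e : R)
  : set X := [set y | d x y < e].

Section metric_topology.
Context {R : realType} {X : topologicalType} (d : X -> X -> R).
Hypothesis dM : is_metric d.

Lemma metric_ge0 x y : 0 <= d x y. Proof. by case: dM. Qed.

Lemma metric_eq0 x y : d x y = 0 -> x = y.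
Proof. by case: dM => _ [h _] /h. Qed.

Lemma metric_refl x : d x x = 0. Proof. by case: dM => _ [h _]; apply/h. Qed.

Lemma metric_sym x y : d x y = d y x. Proof. by case: dM => _ [_ [h _]]. Qed.

Lemma metric_triangle y x z : d x z <= d x y + d y z.
Proof. by case: dM => _ [_ [_ h]]. Qed.

Lemma mball_center x (e : R) : 0 < e -> mball d x e x.
Proof. by move=> e0; rewrite /mball /= metric_refl. Qed.

Hypothesis dT : metric_induces_topology d.

Lemma open_mball x e : open (mball d x e).
Proof.
apply/dT => y /= xy; exists (e - d x y); first by rewrite subr_gt0.
move=> z /= yz; rewrite /mball /=.
by rewrite (le_lt_trans (metric_triangle y x z))// addrC -ltrBrDr.
Qed.

Lemma nbhs_mballP x (A : set X) :
  nbhs x A <-> exists2 e : R, 0 < e & mball d x e `<=` A.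
Proof.
split=> [|[e e0 eA]].
  rewrite nbhsE => -[B [oB Bx] BA].
  by have [e e0 eB] := (dT B).1 oB x Bx; exists e => //; exact: subset_trans BA.
rewrite nbhsE; exists (mball d x e) => //; split; first exact: open_mball.
exact: mball_center.
Qed.

Lemma nbhs_mball x e : 0 < e -> nbhs x (mball d x e).
Proof. by move=> e0; apply/nbhs_mballP; exists e. Qed.

Lemma open_mballP (A : set X) x :
  open A -> A x -> exists2 e : R, 0 < e & mball d x e `<=` A.
Proof. by move=> oA Ax; exact: (dT A).1. Qed.

Lemma closure_metricP (A : set X) x :
  closure A x <-> forall e : R, 0 < e -> exists2 y, A y & d x y < e.
Proof.
split=> [cA e e0|h B /nbhs_mballP[e e0 eB]].
  by have [y [Ay xy]] := cA _ (nbhs_mball x e0); exists y.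
by have [y Ay xy] := h e e0; exists y; split=> //; exact: eB.
Qed.

Lemma metric_hausdorff : hausdorff_space X.
Proof.
move=> x y cxy; apply: metric_eq0; apply/eqP/negPn/negP => xy.
have e0 : 0 < d x y / 2 by rewrite divr_gt0// lt_neqAle eq_sym xy metric_ge0.
have [z [xz yz]] := cxy _ _ (nbhs_mball x e0) (nbhs_mball y e0).
have := metric_triangle z x y; move: xz yz; rewrite /mball /= (metric_sym y z).
lra.
Qed.

End metric_topology.

Lemma continuous_metricP {R : realType} {X Y : topologicalType}
    (d : X -> X -> R) (dY : Y -> Y -> R) (f : X -> Y) :
  is_metric d -> metric_induces_topology d ->
  is_metric dY -> metric_induces_topology dY ->
  continuous f <-> forall x (e : R), 0 < e ->
    exists2 e' : R, 0 < e' & forall x', d x x' < e' -> dY (f x) (f x') < e.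
Proof.
move=> dM dT eM eT; split=> [cf x e e0|h x A /= /(nbhs_mballP eM eT)[e e0 eA]].
  have /(nbhs_mballP dM dT)[e' e'0 h] := cf x _ (nbhs_mball eM eT (f x) e0).
  by exists e'.
have [e' e'0 h'] := h x e e0.
by apply/(nbhs_mballP dM dT); exists e' => // x' /h'; exact: eA.
Qed.

Lemma compact_finite_subcover {X : topologicalType} {I : eqType} (f : I -> set X) :
  compact [set: X] -> (forall i, open (f i)) -> (forall x, exists i, f i x) ->
  exists s : seq I, forall x, exists2 i, i \in s & f i x.
Proof.
move=> /compact_near_coveringP cX fo fc.
(* [F] consists of the sets that contain every list extending some fixed one; near-covering along
   [F] returns a single list that serves all points. *)
pose F : set_system (seq I) :=
  [set A | exists s0 : seq I, forall s : seq I, {subset s0 <= s} -> A s].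
have FF : Filter F.
  split; first by exists [::].
    move=> A B [s hs] [t ht]; exists (s ++ t) => u hu; split.
      by apply: hs => i si; apply: hu; rewrite mem_cat si.
    by apply: ht => i si; apply: hu; rewrite mem_cat si orbT.
  by move=> A B AB [s hs]; exists s => u /hs /AB.
have : \forall s \near F, [set: X] `<=` (fun x => exists2 i, i \in s & f i x).
  apply: (cX _ F (fun s x => exists2 i, i \in s & f i x)) => x _.
  have [i fix_] := fc x.
  exists (f i, [set s | i \in s]) => /=.
    split; first exact: open_nbhs_nbhs.
    by exists [:: i] => s; apply; rewrite inE.
  by move=> [y s] /= [fiy si]; exists i.
by move=> [s /(_ s)] => /(_ (fun _ h => h)) h; exists s => x; exact: h.
Qed.

Lemma act1 {G : groupType} {X : topologicalType} (act : G -> X -> X) :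
  is_action act -> forall x, act 1%g x = x.
Proof. by case. Qed.

Lemma actM {G : groupType} {X : topologicalType} (act : G -> X -> X) :
  is_action act -> forall g h x, act (g * h)%g x = act g (act h x).
Proof. by case=> _ []. Qed.

Lemma act_continuous {G : groupType} {X : topologicalType} (act : G -> X -> X) :
  is_action act -> forall g, continuous (act g).
Proof. by case=> _ []. Qed.

Lemma actK {G : groupType} {X : topologicalType} (act : G -> X -> X) :
  is_action act -> forall g x, act g^-1%g (act g x) = x.
Proof. by move=> h g x; rewrite -actM// mulVg act1. Qed.

Lemma actVK {G : groupType} {X : topologicalType} (act : G -> X -> X) :
  is_action act -> forall g x, act g (act g^-1%g x) = x.
Proof. by move=> h g x; rewrite -actM// mulgV act1. Qed.

Lemma open_act_preimage {G : groupType} {X : topologicalType}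
    (act : G -> X -> X) (g : G) (O : set X) :
  is_action act -> open O -> open (act g @^-1` O).
Proof. by move=> ha oO; apply: open_comp => // x _; exact: act_continuous. Qed.

Section minimal.
Context {G : groupType} {X : topologicalType} (act : G -> X -> X).
Hypotheses (actP : is_action act) (act_min : minimal_system act).

(** The points whose orbit avoids [O] form a closed invariant set; were it nonempty, minimality
    would put the points of [O] in it. *)
Lemma minimal_orbit_dense (O : set X) x :
  open O -> O !=set0 -> exists g, O (act g x).
Proof.
move=> oO [p Op]; apply: contrapT => /forallNP h.
have : [set y | forall g, ~ O (act g y)] = setT.
  apply: act_min; last by move=> g y hy g'; rewrite -actM.
    rewrite (_ : mkset _ = \bigcap_g ~` (act g @^-1` O)).
      by apply: closed_bigI => g _; apply: open_closedC; exact: open_act_preimage.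
    by apply/seteqP; split=> [y hy g _|y hy g]; [exact: hy|exact: (hy g)].
  by exists x.
move/seteqP => -[_ /(_ p I)] /(_ 1%g) /=.
by rewrite act1.
Qed.

(** Every orbit enters [O], so the preimages of [O] cover [X] and finitely many suffice. Later
    positivity arguments sum over this list [s]. *)
Lemma minimal_syndetic (O : set X) : compact [set: X] -> open O -> O !=set0 ->
  exists s : seq G, forall x, exists2 g, g \in s & O (act g x).
Proof.
move=> cX oO nO.
apply: (@compact_finite_subcover _ _ (fun g => act g @^-1` O)) => // [g|x].
  exact: open_act_preimage.
exact: minimal_orbit_dense.
Qed.

End minimal.

(** A finite form of Baire's theorem: either [O] lies in the first closed set, or removing that set
    leaves a nonempty open set covered by the others. *)
Lemma finite_closed_cover_interior {Y : topologicalType} {I : eqType}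
    (f : I -> set Y) (s : seq I) (O : set Y) :
  (forall i, closed (f i)) -> open O -> O !=set0 ->
  (forall y, O y -> exists2 i, i \in s & f i y) ->
  exists2 i, i \in s & exists O', [/\ open O', O' !=set0 & O' `<=` f i].
Proof.
move=> cf; elim: s O => [|i s IH] O oO nO cO.
  by have [y Oy] := nO; have [] := cO y Oy.
have [Oi|/nonsubset[y [Oy fy]]] := pselect (O `<=` f i).
  by exists i; [rewrite inE eqxx|exists O].
have [ | | z [hz fz]|j js [P ?]] := IH (O `&` ~` f i).
- by apply: openI => //; exact: closed_openC.
- by exists y.
- have [j] := cO _ hz; rewrite inE => /orP[/eqP->//|js fj].
  by exists j.
- by exists j; [rewrite inE js orbT|exists P].
Qed.

(** * Factors and the maximal equicontinuous factor *)

Section factor_interior.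
Context {R : realType} {G : groupType} {X Y : topologicalType}.
Context (d : X -> X -> R) (act : G -> X -> X) (actY : G -> Y -> Y) (pi : X -> Y).
Hypotheses (dX : compact_metric_space d) (actP : is_action act).
Hypotheses (act_min : minimal_system act) (actYP : is_action actY).
Hypotheses (Yhaus : hausdorff_space Y) (piP : factor_map act actY pi).

Lemma closed_factor_image (C : set X) : closed C -> closed (pi @` C).
Proof.
move=> cC; apply: compact_closed => //; apply: continuous_compact.
  by apply: continuous_subspaceT; case: piP.
by have [_ [_ cX]] := dX; exact: (subclosed_compact cC cX).
Qed.

(* Finitely many translates of a closed neighbourhood inside [W] cover [X], so
   one of the corresponding closed pieces of [Y] has interior. *)
Lemma factor_image_interior (W : set X) : open W -> W !=set0 ->
  exists B : set Y, [/\ open B, B !=set0 & B `<=` pi @` W].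
Proof.
have [dM [dT cX]] := dX; have [pic [pis pie]] := piP.
move=> oW [x Wx]; have [e e0 eW] := open_mballP dT oW Wx.
pose W' := mball d x (e / 2).
have e20 : 0 < e / 2 by rewrite divr_gt0.
have clW' : closure W' `<=` W.
  move=> z /(closure_metricP dM dT) /(_ _ e20)[y W'y zy]; apply: eW.
  have := metric_triangle dM y x z; move: W'y zy.
  rewrite /W' /mball /= (metric_sym dM z); lra.
have [s hs] := minimal_syndetic actP act_min cX (open_mball dM dT x (e / 2))
  (ex_intro _ x (mball_center dM x e20)).
have [ | | | | g gs [P [oP [y Py] Ps]]] :=
  @finite_closed_cover_interior _ _ (fun g => pi @` (act g @^-1` closure W')) s setT.
- move=> g; apply: closed_factor_image; apply: closed_comp.
    by move=> z _; exact: act_continuous.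
  exact: closed_closure.
- exact: openT.
- by exists (pi x).
- move=> y _; have [z <-] := pis y; have [g gs hz] := hs z.
  by exists g => //; exists z => //; exact: subset_closure.
(* Each point of [P] has a lift that [g] carries into [W], so the translate of [P] by [g] lies in
   the image of [W]. *)
exists (actY g^-1%g @^-1` P); split.
- exact: open_act_preimage.
- by exists (actY g y); rewrite /= actK.
- move=> u /= /Ps[z /= hz zu]; exists (act g z); first exact: clW'.
  by rewrite pie zu actVK.
Qed.

Lemma factor_minimal : minimal_system actY.
Proof.
move=> A cA [y Ay] iA; have [pic [pis pie]] := piP.
have : pi @^-1` A = setT.
  apply: act_min.
  - by apply: closed_comp => // x _; exact: pic.
  - by have [x xy] := pis y; exists x; rewrite /= xy.
  - by move=> g x /= Ax; rewrite pie; exact: iA.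
move/seteqP => -[_ h]; apply/seteqP; split => // z _.
by have [x <-] := pis z; exact: h.
Qed.

End factor_interior.

Definition pm_rep {R : realType} {X : choiceType} (rho : X -> X -> R) (x : X) : X :=
  xget x [set y | rho x y = 0].

Definition pm_quot {R : realType} {X : choiceType} (rho : X -> X -> R) :=
  {x : X | pm_rep rho x == x}.

Section pseudometric_quotient_topology.
Context {R : realType} {X : choiceType} (rho : X -> X -> R).

HB.instance Definition _ := Choice.on (pm_quot rho).

Definition pm_open : set_system (pm_quot rho) := [set A |
  forall x, A x -> exists2 e : R, 0 < e & [set y | rho (val x) (val y) < e] `<=` A].

Let pm_openT : pm_open setT. Proof. by move=> x _; exists 1. Qed.

Let pm_openI : setI_closed pm_open.
Proof.
move=> A B oA oB x [Ax Bx]; have [e e0 eA] := oA x Ax; have [f f0 fB] := oB x Bx.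
exists (Num.min e f); first by rewrite lt_min e0.
by move=> y /=; rewrite lt_min => /andP[? ?]; split; [exact: eA|exact: fB].
Qed.

Let pm_open_bigU (I : Type) (f : I -> set (pm_quot rho)) :
  (forall i, pm_open (f i)) -> pm_open (\bigcup_i f i).
Proof.
move=> fo x [i _ fx]; have [e e0 ef] := fo i x fx.
by exists e => // y /ef ?; exists i.
Qed.

HB.instance Definition _ :=
  isOpenTopological.Build (pm_quot rho) pm_openT pm_openI pm_open_bigU.

End pseudometric_quotient_topology.

Section max_equicontinuous_factor.
Context {R : realType} {G : groupType} {X Y : topologicalType}.
Context (d : X -> X -> R) (act : G -> X -> X).
Context (dY : Y -> Y -> R) (actY : G -> Y -> Y) (pi : X -> Y).
Hypotheses (dX : compact_metric_space d) (actP : is_action act).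
Hypothesis piP : max_equicontinuous_factor act dY actY pi.

(* The quotient by the zero set of [rho] is an isometric factor, hence a factor
   of [Y]. *)
Lemma invariant_pseudometric_fiber (rho : X -> X -> R) :
  (forall x y, 0 <= rho x y) -> (forall x, rho x x = 0) ->
  (forall x y, rho x y = rho y x) ->
  (forall x y z, rho x z <= rho x y + rho y z) ->
  (forall g x y, rho (act g x) (act g y) = rho x y) ->
  (forall x (e : R), 0 < e ->
     exists2 e' : R, 0 < e' & forall x', d x x' < e' -> rho x x' < e) ->
  forall x x', pi x = pi x' -> rho x x' = 0.
Proof.
move=> rge0 rxx rsym rtri rinv rcont; have [dM [dT cX]] := dX.
have rep0 x : rho x (pm_rep rho x) = 0.
  by rewrite /pm_rep; case: xgetP => // h; have := h x; rewrite /= rxx.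
have rep_eq x x' : rho x x' = 0 -> pm_rep rho x = pm_rep rho x'.
  move=> xx'; have E : [set y | rho x y = 0] = [set y | rho x' y = 0].
    apply/seteqP; split=> y /= hy; apply/eqP; rewrite eq_le rge0 andbT.
      by rewrite (le_trans (rtri _ x _))// rsym xx' hy addr0.
    by rewrite (le_trans (rtri _ x' _))// xx' hy addr0.
  rewrite /pm_rep E /xget; case: pselect => // -[].
  by exists x'; apply/mem_set; rewrite /= rxx.
have rep_id x : pm_rep rho (pm_rep rho x) == pm_rep rho x.
  by apply/eqP; rewrite -(rep_eq _ _ (rep0 x)).
pose Z := pm_quot rho.
pose q (x : X) : Z := exist _ (pm_rep rho x) (rep_id x).
have qv (z : Z) : q (val z) = z by apply: val_inj; rewrite /=; apply/eqP; exact: (valP z).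
have rq x y : rho (pm_rep rho x) (pm_rep rho y) = rho x y.
  apply/eqP; rewrite eq_le; apply/andP; split.
    rewrite (le_trans (rtri _ x _))// rsym rep0 add0r.
    by rewrite (le_trans (rtri _ y _))// rep0 addr0.
  rewrite (le_trans (rtri _ (pm_rep rho x) _))// rep0 add0r.
  by rewrite (le_trans (rtri _ (pm_rep rho y) _))// (rsym _ y) rep0 addr0.
pose dZ (z w : Z) := rho (val z) (val w).
have dZM : is_metric dZ.
  split; first by move=> *; exact: rge0.
  split; last by split=> *; [exact: rsym|exact: rtri].
  move=> z w; split=> [zw|->]; last exact: rxx.
  by rewrite -(qv z) -(qv w); apply: val_inj => /=; exact: rep_eq.
have dZT : metric_induces_topology dZ by [].
have qc : continuous q.
  apply/(continuous_metricP _ dM dT dZM dZT) => x e e0.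
  by have [e' e'0 h] := rcont x e e0; exists e' => // x' /h; rewrite /dZ /= rq.
have cZ : compact [set: Z].
  rewrite (_ : setT = q @` setT).
    by apply: continuous_compact => //; exact: continuous_subspaceT.
  by apply/seteqP; split=> // z _; exists (val z).
pose actZ g (z : Z) : Z := q (act g (val z)).
have actZq g x : actZ g (q x) = q (act g x).
  by apply: val_inj => /=; apply: rep_eq; rewrite rinv rsym rep0.
have aZ : is_action actZ.
  split; first by move=> z; rewrite /actZ act1.
  split; first by move=> g h z; rewrite -(qv z) !actZq actM.
  move=> g; apply/(continuous_metricP _ dZM dZT dZM dZT) => z e e0.
  by exists e => // z'; rewrite /dZ /= rq rinv.
have eZ : equicontinuous_system dZ actZ.
  by move=> e e0; exists e => // z z' zz' g; rewrite /dZ /= rq rinv.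
have fZ : factor_map act actZ q.
  by split=> //; split=> [z|g x]; [exists (val z)|rewrite actZq].
(* Maximality of [pi] factors [q] through it, so points with equal image under [pi] have the same
   representative. *)
have [_ [_ [_ [_ /(_ _ dZ actZ q)]]]] := piP.
move=> /(_ (conj dZM (conj dZT cZ)) aZ eZ fZ)[phi [_ qphi]] x x' xx'.
by rewrite -rq -[pm_rep rho x]/(val (q x)) -[pm_rep rho x']/(val (q x')) !qphi xx' rxx.
Qed.

End max_equicontinuous_factor.

(** The metric is the supremum over the group of the translated distances, truncated at 1 to stay
    bounded; equicontinuity keeps the topology unchanged. *)
Lemma equicontinuous_invariant_metric {R : realType} {G : groupType}
    {Y : topologicalType} (dY : Y -> Y -> R) (actY : G -> Y -> Y) :
  compact_metric_space dY -> is_action actY -> equicontinuous_system dY actY ->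
  exists2 rho : Y -> Y -> R, compact_metric_space rho &
    forall g y y', rho (actY g y) (actY g y') = rho y y'.
Proof.
move=> [dM [dT cY]] aY eY.
pose S (y y' : Y) : set R := range (fun g => Num.min 1 (dY (actY g y) (actY g y'))).
pose rho y y' := sup (S y y').
have S0 y y' : S y y' !=set0 by exists (Num.min 1 (dY (actY 1%g y) (actY 1%g y'))), 1%g.
have hS y y' : has_sup (S y y').
  by split=> //; exists 1 => _ [g _ <-]; rewrite ge_min lexx.
have rub y y' g : Num.min 1 (dY (actY g y) (actY g y')) <= rho y y'.
  by apply: ub_le_sup; [case: (hS y y')|exists g].
have rle y y' b : (forall g, Num.min 1 (dY (actY g y) (actY g y')) <= b) -> rho y y' <= b.
  by move=> h; apply: sup_le_ub => // _ [g _ <-].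
have rge y y' : Num.min 1 (dY y y') <= rho y y' by have := rub y y' 1%g; rewrite !act1.
have min_ge0 g y y' : 0 <= Num.min 1 (dY (actY g y) (actY g y')).
  by rewrite le_min ler01 metric_ge0.
have rM : is_metric rho.
  split; first by move=> y y'; exact: le_trans (min_ge0 1%g y y') (rub _ _ _).
  split.
    move=> y y'; split=> [r0|->].
      apply: (metric_eq0 dM); apply/eqP; rewrite eq_le metric_ge0// andbT.
      by have := rge y y'; rewrite r0 ge_min ler10.
    apply/eqP; rewrite eq_le (le_trans (min_ge0 1%g _ _) (rub _ _ _)) andbT.
    by apply: rle => g; rewrite metric_refl// ge_min lexx orbT.
  split.
    by move=> y y'; rewrite /rho /S; under eq_fun do rewrite (metric_sym dM).
  move=> x y z; apply: rle => g.
  have := rub x y g; have := rub y z g.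
  have := metric_triangle dM (actY g y) (actY g x) (actY g z).
  have := metric_ge0 dM (actY g x) (actY g y).
  have := metric_ge0 dM (actY g y) (actY g z).
  rewrite !minElt; case: ifPn; case: ifPn; case: ifPn; rewrite -?leNgt; lra.
exists rho; last first.
  move=> g y y'; apply/eqP; rewrite eq_le; apply/andP; split; apply: rle => h.
    by rewrite -!actM.
  have := rub (actY g y) (actY g y') (h * g^-1)%g.
  by rewrite !actM// !actK.
split=> //; split=> // A; split.
  move=> oA x Ax; have [e e0 eA] := open_mballP dT oA Ax.
  exists (Num.min 1 e); first by rewrite lt_min ltr01.
  move=> y /= xy; apply: eA; rewrite /mball /=.
  have := le_lt_trans (rge x y) xy.
  by rewrite !minElt; case: ifPn; case: ifPn; rewrite -?leNgt; lra.
move=> h; apply/dT => x Ax; have [e e0 eA] := h x Ax.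
(* Half of [e], because the supremum turns strict bounds into weak ones. *)
have [e' e'0 he'] := eY (e / 2) (divr_gt0 e0 (ltr0Sn _ 1)).
exists e' => // y /= xy; apply: eA => /=.
apply: (@le_lt_trans _ _ (e / 2)); last by rewrite ltr_pdivrMr// ltr_pMr// ltr1n.
by apply: rle => g; rewrite ge_min (ltW (he' _ _ xy g)) orbT.
Qed.

(** * Invariant means *)

Definition bnd {R : realType} {T : Type} (f : T -> R) : Prop :=
  exists B : R, forall x, `|f x| <= B.

Definition ind {R : realType} {T : Type} (A : set T) (x : T) : R := `[< A x >]%:R.

Section bounded_functions.
Context {R : realType} {T : Type}.
Implicit Types f g : T -> R.

Lemma bnd_cst (c : R) : bnd (fun _ : T => c).
Proof. by exists `|c|. Qed.

Lemma bnd_add f g : bnd f -> bnd g -> bnd (fun x => f x + g x).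
Proof.
move=> [B hB] [C hC]; exists (B + C) => x.
by rewrite (le_trans (ler_normD _ _))// lerD.
Qed.

Lemma bnd_scale (c : R) f : bnd f -> bnd (fun x => c * f x).
Proof.
move=> [B hB]; exists (`|c| * B) => x; by rewrite normrM ler_wpM2l.
Qed.

Lemma bnd_ind (A : set T) : bnd (ind A : T -> R).
Proof. by exists 1 => x; rewrite /ind; case: asbool; rewrite ?normr1// normr0. Qed.

Lemma ind_ge0 (A : set T) x : 0 <= ind A x :> R.
Proof. exact: ler0n. Qed.

Lemma ind_le1 (A : set T) x : ind A x <= 1 :> R.
Proof. by rewrite /ind; case: asbool. Qed.

Lemma indT (A : set T) x : A x -> ind A x = 1 :> R.
Proof. by move=> Ax; rewrite /ind asboolT. Qed.

Lemma indF (A : set T) x : ~ A x -> ind A x = 0 :> R.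
Proof. by move=> Ax; rewrite /ind asboolF. Qed.

Lemma ind_sub (A B : set T) x : (A x -> B x) -> ind A x <= ind B x :> R.
Proof.
move=> AB; have [Ax|nAx] := pselect (A x); first by rewrite !indT//; exact: AB.
by rewrite indF// ind_ge0.
Qed.

End bounded_functions.

Lemma bnd_comp {R : realType} {T T' : Type} (h : T' -> T) (f : T -> R) :
  bnd f -> bnd (fun x => f (h x)).
Proof. by move=> [B hB]; exists B => x. Qed.

#[global] Hint Resolve bnd_cst bnd_add bnd_scale bnd_ind : core.

(** A finitely additive mean. The laws concern bounded functions only, for which averages converge
    along an ultrafilter. *)
Record is_mean {R : realType} {T : Type} (M : (T -> R) -> R) : Prop := IsMean {
  meanD : forall f g, bnd f -> bnd g -> M (fun x => f x + g x) = M f + M g ;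
  meanZ : forall c f, bnd f -> M (fun x => c * f x) = c * M f ;
  mean_le : forall f g, bnd f -> bnd g -> (forall x, f x <= g x) -> M f <= M g ;
  mean1 : M (fun=> 1) = 1 }.

Section mean_theory.
Context {R : realType} {T : Type} (M : (T -> R) -> R).
Hypothesis MP : is_mean M.

Lemma eq_mean f g : (forall x, f x = g x) -> M f = M g.
Proof. by move=> fg; congr M; apply/funext. Qed.

Lemma mean_cst c : M (fun=> c) = c.
Proof.
rewrite (@eq_mean _ (fun=> c * 1)); first by rewrite (meanZ MP)// (mean1 MP) mulr1.
by move=> _; rewrite mulr1.
Qed.

Lemma mean_ge0 f : bnd f -> (forall x, 0 <= f x) -> 0 <= M f.
Proof. by move=> bf f0; rewrite -[leLHS](mean_cst 0); exact: (mean_le MP). Qed.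

Lemma meanN f : bnd f -> M (fun x => - f x) = - M f.
Proof.
move=> bf; rewrite (@eq_mean _ (fun x => -1 * f x)) ?(meanZ MP)// ?mulN1r// => x.
by rewrite mulN1r.
Qed.

Lemma mean_sum (I : Type) (s : seq I) (f : I -> T -> R) :
  (forall i, bnd (f i)) -> bnd (fun x => \sum_(i <- s) f i x) /\
  M (fun x => \sum_(i <- s) f i x) = \sum_(i <- s) M (f i).
Proof.
move=> bf; elim: s => [|i s [IHb IH]].
  have E x : \sum_(i <- [::]) f i x = 0 by rewrite big_nil.
  rewrite (funext E) big_nil mean_cst; split=> //; exact: bnd_cst.
have E x : \sum_(j <- i :: s) f j x = f i x + \sum_(j <- s) f j x by rewrite big_cons.
by rewrite (funext E) big_cons (meanD MP)// IH; split=> //; exact: bnd_add.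
Qed.

Lemma mean_ind_ge0 A : 0 <= M (ind A).
Proof. by apply: mean_ge0 => // x; exact: ind_ge0. Qed.

Lemma mean_ind_le A B : A `<=` B -> M (ind A) <= M (ind B).
Proof. by move=> AB; apply: (mean_le MP) => // x; apply: ind_sub; exact: AB. Qed.

Lemma mean_indC A : M (ind (~` A)) = 1 - M (ind A).
Proof.
rewrite -(mean1 MP) -meanN// -(meanD MP)//; last first.
  by rewrite -[bnd _]/(bnd (fun x => - ind A x)); under eq_fun do rewrite -mulN1r; exact: bnd_scale.
apply: eq_mean => x; have [Ax|nAx] := pselect (A x).
  by rewrite (indT Ax) indF ?subrr// => /(_ Ax).
by rewrite (indF nAx) indT ?subr0.
Qed.

Lemma mean_ind_gt0 A : 0 < M (ind A) -> A !=set0.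
Proof.
move=> A0; apply: contrapT => nA; move: A0.
rewrite (@eq_mean _ (fun=> 0)) ?mean_cst ?ltxx// => x.
by rewrite indF// => Ax; apply: nA; exists x.
Qed.

End mean_theory.

Definition favg {R : realType} {G : Type} (F : nat -> seq G) (f : G -> R) (n : nat) : R :=
  (\sum_(g <- F n) f g) / (size (F n))%:R.

Lemma countE {R : realType} {T : Type} (a : pred T) (s : seq T) :
  (count a s)%:R = \sum_(x <- s) (a x)%:R :> R.
Proof. by elim: s => [|x s IH] /=; rewrite ?big_nil// big_cons natrD IH. Qed.

(** The common entries cancel, as each occurs exactly once in both lists. *)
Lemma sum_symdiff_le {R : realType} {G : eqType} (f : G -> R) (B : R) (s t : seq G) :
  (forall x, `|f x| <= B) -> uniq s -> uniq t ->
  `|\sum_(x <- s) f x - \sum_(x <- t) f x| <= B * (symdiff_size s t)%:R.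
Proof.
move=> fB us ut.
have half u (a : pred G) : `|\sum_(x <- u | a x) f x| <= B * (count a u)%:R.
  rewrite (le_trans (ler_norm_sum _ _ _))// countE mulr_sumr big_mkcond/=.
  by apply: ler_sum => x _; case: (a x); rewrite ?mulr1 ?mulr0.
rewrite (bigID (mem t))/= [X in _ - X](bigID (mem s))/= opprD addrACA.
have -> : \sum_(x <- s | x \in t) f x = \sum_(x <- t | x \in s) f x.
  rewrite -[LHS]big_filter -[RHS]big_filter; apply: perm_big.
  by apply: uniq_perm; rewrite ?filter_uniq// => x; rewrite !mem_filter andbC.
rewrite subrr add0r (le_trans (ler_normB _ _))// /symdiff_size natrD mulrDr.
by apply: lerD; exact: half.
Qed.

Section folner_mean.
Context {R : realType} {G : groupType} (F : nat -> seq G).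
Hypothesis FP : Folner_seq (R := R) F.

Lemma folner_size_gt0 n : 0 < (size (F n))%:R :> R.
Proof. by rewrite ltr0n; case: FP => /(_ n)[_]; case: (F n). Qed.

Lemma folner_shift (f : G -> R) (B : R) g n : (forall x, `|f x| <= B) ->
  `|\sum_(h <- F n) f (g * h)%g - \sum_(h <- F n) f h| <=
  B * (symdiff_size (map (fun h => (g * h)%g) (F n)) (F n))%:R.
Proof.
move=> fB; have [uF _] := FP.1 n.
rewrite -(big_map (fun h => (g * h)%g) xpredT); apply: sum_symdiff_le => //.
by rewrite map_inj_uniq//; exact: mulgI.
Qed.

Lemma favg_bnd (f : G -> R) B n : (forall x, `|f x| <= B) -> `|favg F f n| <= B.
Proof.
move=> fB; rewrite /favg normrM normfV (ger0_norm (ltW (folner_size_gt0 n))).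
rewrite ler_pdivrMr ?folner_size_gt0// (le_trans (ler_norm_sum _ _ _))//.
elim: (F n) => [|x s IH]; first by rewrite big_nil mulr0.
by rewrite big_cons/= -natr1 mulrDr mulr1 addrC lerD.
Qed.

(* The mean is the limit of the averages along an ultrafilter. *)
Lemma folner_mean : exists M : (G -> R) -> R, [/\ is_mean M,
  (forall g f, bnd f -> M (fun x => f (g * x)%g) = M f) &
  (forall f c, bnd f -> (\forall n \near \oo, favg F f n <= c) -> M f <= c)].
Proof.
have [U [Uu sU]] := ultraFilterLemma (@eventually_filter).
pose M (f : G -> R) : R := lim (favg F f @ U).
(* The averages stay in a compact interval, so their image ultrafilter converges. *)
have Mcvg f : bnd f -> favg F f @ U --> M f.
  move=> [B hB]; have Uf : UltraFilter (favg F f @ U).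
    split; first exact: fmap_proper_filter.
    move=> H HP UH; apply/seteqP; split=> // A HA.
    have [//|UA] := in_ultra_setVsetC (favg F f @^-1` A) Uu.
    exfalso; have : H (A `&` ~` A) by apply: filterI => //; exact: UH.
    by rewrite setICr => /filter_ex[].
  have := @segment_compact R (- B) B; rewrite compact_ultra => /(_ _ Uf)[].
    by apply: (@filterE _ U) => n; have := favg_bnd n hB; rewrite ler_norml /= in_itv.
  by move=> p [_ /= hp]; exact: (cvgP _ hp).
have Meq f l : favg F f @ U --> l -> M f = l by move=> h; exact: cvg_lim.
exists M; split.
- split.
  + move=> f g bf bg; apply: Meq.
    rewrite (_ : favg F _ = favg F f \+ favg F g).
      by apply: cvgD; exact: Mcvg.
    by apply/funext => n; rewrite /favg /= big_split mulrDl.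
  + move=> c f bf; apply: Meq.
    rewrite (_ : favg F _ = fun n => c * favg F f n).
      by apply: cvgMr; exact: Mcvg.
    by apply/funext => n; rewrite /favg mulrA mulr_sumr.
  + move=> f g bf bg fg; apply: (ler_cvg_to (Mcvg _ bf) (Mcvg _ bg)).
    apply: filterE => n; rewrite /favg ler_pM2r ?invr_gt0 ?folner_size_gt0//.
    by apply: ler_sum.
  + apply: Meq; rewrite (_ : favg F _ = fun=> 1); first exact: cvg_cst.
    apply/funext => n; rewrite /favg big_const_seq count_predT iter_addr addr0.
    by rewrite divff// gt_eqF// folner_size_gt0.
- move=> g f bf; apply: Meq; have [B hB] := bf.
  pose u n : R := (symdiff_size (map (fun h => (g * h)%g) (F n)) (F n))%:R /
    (size (F n))%:R.
  have B0 : 0 <= B by exact: le_trans (hB 1%g).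
  have u0 : (fun n => B * u n) @ U --> (0 : R).
    rewrite -[0](mulr0 B); apply: cvgMr.
    by move=> A /(FP.2 g) /sU.
  (* The difference of the two averages is at most [B * u n], which tends to 0 by the Følner
     property. *)
  rewrite (_ : favg F _ = fun n => favg F f n + (favg F (fun x => f (g * x)%g) n - favg F f n)).
    rewrite -[M f]addr0; apply: cvgD; first exact: Mcvg.
    apply/norm_cvg0P; apply: (@squeeze_cvgr _ _ _ _ (fun=> 0) (fun n => B * u n)) => //.
      apply: filterE => n; rewrite normr_ge0/= /favg -mulrBl normrM normfV.
      rewrite (ger0_norm (ltW (folner_size_gt0 n))) /u mulrA.
      by rewrite ler_pM2r ?invr_gt0 ?folner_size_gt0// folner_shift.
    exact: cvg_cst.
  by apply/funext => n; rewrite addrC subrK.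
- move=> f c bf h.
  have cc : (fun _ : nat => c) @ U --> c by exact: cvg_cst.
  exact: (ler_cvg_to (Mcvg _ bf) cc (sU _ h)).
Qed.

End folner_mean.

(** The [n]-fold product of [M], evaluated on lists of length [n], with the head as outermost
    variable. *)
Fixpoint mean_iter {R : realType} {T : Type} (M : (T -> R) -> R) (n : nat)
    (f : seq T -> R) : R :=
  if n is n'.+1 then M (fun g => mean_iter M n' (fun s => f (g :: s))) else f [::].

Section iterated_mean.
Context {R : realType} {G : groupType} (M : (G -> R) -> R).
Hypothesis MP : is_mean M.

Lemma mean_norm_le {T : Type} (L : (T -> R) -> R) f B : is_mean L ->
  (forall x, `|f x| <= B) -> `|L f| <= B.
Proof.
move=> LP fB; have bf : bnd f by exists B.
have h x : - B <= f x <= B by rewrite -ler_norml.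
rewrite ler_norml -{1}(mean_cst LP (- B)) -{2}(mean_cst LP B).
by apply/andP; split; apply: (mean_le LP) => // x; have /andP[] := h x.
Qed.

Lemma mean_iter_norm_le n f B : (forall s, `|f s| <= B) -> `|mean_iter M n f| <= B.
Proof.
elim: n f => [|n IH] f fB //=; apply: (mean_norm_le MP) => g.
by apply: IH => s; exact: fB.
Qed.

Lemma bnd_mean_iter n f : bnd f -> bnd (fun g => mean_iter M n (fun s => f (g :: s))).
Proof. by move=> [B fB]; exists B => g; apply: mean_iter_norm_le. Qed.

Lemma eq_mean_iter n f f' : (forall s, size s = n -> f s = f' s) ->
  mean_iter M n f = mean_iter M n f'.
Proof.
elim: n f f' => [|n IH] f f' ff' /=; first exact: ff'.
by apply: eq_mean => g; apply: IH => s sn; apply: ff'; rewrite /= sn.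
Qed.

Lemma mean_iter_is_mean n : is_mean (mean_iter M n).
Proof.
elim: n => [|n IH]; first by split=> //= f g _ _ fg; exact: fg.
split=> /=.
- move=> f g bf bg; rewrite -(meanD MP); [|exact: bnd_mean_iter..].
  by apply: eq_mean => x; rewrite -(meanD IH)//; exact: bnd_comp.
- move=> c f bf; rewrite -(meanZ MP); last exact: bnd_mean_iter.
  by apply: eq_mean => x; rewrite -(meanZ IH)//; exact: bnd_comp.
- move=> f g bf bg fg; apply: (mean_le MP); [exact: bnd_mean_iter..|move=> x].
  by apply: (mean_le IH) => [||s]; [exact: bnd_comp..|exact: fg].
- by rewrite -[RHS](mean1 MP); apply: eq_mean => x; exact: (mean1 IH).
Qed.

Lemma mean_iter_shift n g f :
  (forall h f', bnd f' -> M (fun x => f' (h * x)%g) = M f') -> bnd f ->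
  mean_iter M n (fun s => f (map (fun h => (g * h)%g) s)) = mean_iter M n f.
Proof.
move=> Minv; elim: n f => [|n IH] f bf //=.
rewrite -[RHS](Minv g); last exact: bnd_mean_iter.
by apply: eq_mean => x; rewrite (IH (fun s => f ((g * x)%g :: s)))//; exact: bnd_comp.
Qed.

(** The mean of a box is the product of the means of its sides: slicing at the head [g] leaves the
    smaller box or nothing. *)
Lemma mean_iter_box_gt0 n (A : nat -> set G) : (forall i, 0 < M (ind (A i))) ->
  0 < mean_iter M n (ind [set s | forall i, (i < size s)%N -> A i (nth 1%g s i)]).
Proof.
elim: n A => [|n IH] A A0 /=; first by rewrite indT.
set c := mean_iter M n (ind [set s | forall i, (i < size s)%N -> A i.+1 (nth 1%g s i)]).
have c0 : 0 < c by apply: (IH (fun i => A i.+1)) => i; exact: A0.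
rewrite (@eq_mean _ _ _ _ (fun g => c * ind (A 0%N) g)).
  by rewrite (meanZ MP)// mulr_gt0.
move=> g; have [Ag|nAg] := pselect (A 0%N g).
  rewrite indT// mulr1; apply: eq_mean_iter => s _; rewrite /ind; congr (_%:R).
  congr nat_of_bool; apply: asbool_equiv_eq; split=> /= [h i si|h [|i] //].
    exact: (h i.+1).
  exact: h.
rewrite (indF nAg) mulr0 -[RHS](mean_cst (mean_iter_is_mean n) 0).
by apply: eq_mean_iter => s _; rewrite indF// => /(_ 0%N isT).
Qed.

End iterated_mean.

(** For nondecreasing [phi] this is the right limit at 0. *)
Definition pinf {R : realType} (phi : R -> R) : R := inf [set phi e | e in [set e | 0 < e]].

Section pinf_theory.
Context {R : realType}.
Implicit Types phi psi : R -> R.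

Lemma pinf_has_inf phi : (forall e, 0 <= phi e) ->
  has_inf [set phi e | e in [set e | 0 < e]].
Proof.
by move=> p0; split; [exists (phi 1), 1 => //=|exists 0 => _ [e _ <-]].
Qed.

Lemma pinf_le phi e : (forall e, 0 <= phi e) -> 0 < e -> pinf phi <= phi e.
Proof.
by move=> p0 e0; apply: inf_lbound; [case: (pinf_has_inf p0)|exists e].
Qed.

Lemma le_pinf phi b : (forall e, 0 < e -> b <= phi e) -> b <= pinf phi.
Proof.
move=> h; apply: lb_le_inf; first by exists (phi 1), 1 => //=.
by move=> _ [e e0 <-]; exact: h.
Qed.

Lemma pinf_lt phi b : (forall e, 0 <= phi e) -> pinf phi < b ->
  exists2 e, 0 < e & phi e < b.
Proof.
move=> p0 pb; apply: contrapT => nh; move: pb; rewrite ltNge => /negP; apply.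
apply: le_pinf => e e0; rewrite leNgt; apply/negP => eb; apply: nh.
by exists e.
Qed.

End pinf_theory.

(** * McMahon's pseudometric attached to a family of sections *)

Section relative_mean.
Context {R : realType} {G : groupType} {X Y : topologicalType}.
Context (d : X -> X -> R) (act : G -> X -> X).
Context (dY : Y -> Y -> R) (actY : G -> Y -> Y) (pi : X -> Y).
Hypotheses (dX : compact_metric_space d) (actP : is_action act).
Hypothesis act_min : minimal_system act.
Hypothesis piP : max_equicontinuous_factor act dY actY pi.
Context {T : Type} (L : (T -> R) -> R) (tact : G -> T -> T) (E : R -> X -> set T).
Hypothesis LP : is_mean L.
Hypothesis Linv : forall g f, bnd f -> L (fun t => f (tact g t)) = L f.
Hypothesis E_mono : forall e e' c, e <= e' -> E e c `<=` E e' c.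
Hypothesis E_usc : forall e c c', 0 < e -> d c c' < e -> E e c' `<=` E (e + e) c.
Hypothesis E_equiv : forall g e, 0 < e -> exists2 e', 0 < e' &
  forall c t, E e' c t -> E e (act g c) (tact g t).

(** [E e c] stands for the [e]-neighbourhood of the section over [c] of a closed invariant relation.
    Since [L] is only finitely additive, [fl] and [kap] measure sections and their intersections
    through shrinking neighbourhoods. *)
Let lam c e := L (ind (E e c)).
Let lam2 c c' e := L (ind (E e c `&` E e c')).
Let fl c := pinf (lam c).
Let kap c c' := pinf (lam2 c c').

Let lam_ge0 c e : 0 <= lam c e. Proof. exact: mean_ind_ge0. Qed.
Let lam2_ge0 c c' e : 0 <= lam2 c c' e. Proof. exact: mean_ind_ge0. Qed.

Let lam_mono c e e' : e <= e' -> lam c e <= lam c e'.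
Proof. by move=> ee'; apply: mean_ind_le => //; exact: E_mono. Qed.

Let lam2_mono c c' e e' : e <= e' -> lam2 c c' e <= lam2 c c' e'.
Proof. by move=> ee'; apply: mean_ind_le => //; apply: setISS; exact: E_mono. Qed.

Let kap_act_le g c c' : kap c c' <= kap (act g c) (act g c').
Proof.
apply: le_pinf => e e0; have [e' e'0 h] := E_equiv g e0.
apply: (le_trans (pinf_le (lam2_ge0 c c') e'0)).
rewrite /lam2 -[leRHS](Linv g)//; apply: (mean_le LP) => // [|t]; first exact: bnd_comp.
apply: (@ind_sub R T _ (tact g @^-1` (E e (act g c) `&` E e (act g c')))).
by move=> -[? ?]; split; exact: h.
Qed.

Let kap_act g c c' : kap (act g c) (act g c') = kap c c'.
Proof.
apply/eqP; rewrite eq_le kap_act_le andbT.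
by have := kap_act_le g^-1%g (act g c) (act g c'); rewrite !actK.
Qed.

Let fl_kap c : fl c = kap c c.
Proof. by rewrite /fl /kap /lam2; congr pinf; apply/funext => e; rewrite setIid. Qed.

(** [fl] is upper semicontinuous and invariant, so its superlevel sets are closed and invariant, and
    minimality applies. *)
Let fl_cst c c' : fl c = fl c'.
Proof.
have [dM [dT _]] := dX.
suff H a b : fl b <= fl a by apply/eqP; rewrite eq_le !H.
have : [set x | fl b <= fl x] = setT.
  apply: act_min.
  - rewrite -[X in closed X]setCK; apply: open_closedC; apply/dT => x /= /negP.
    rewrite -ltNge => /(pinf_lt (lam_ge0 x))[e e0 he].
    exists (e / 2); first by rewrite divr_gt0.
    move=> y /= xy; apply/negP; rewrite -ltNge; apply: le_lt_trans he.
    apply: (@le_trans _ _ (lam y (e / 2))).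
      by apply: pinf_le => //; rewrite divr_gt0.
    apply: mean_ind_le => //; have := @E_usc (e / 2) x y.
    by rewrite -splitr; apply => //; rewrite divr_gt0.
  - by exists b => /=.
  - by move=> g x /=; rewrite !fl_kap kap_act.
by move/seteqP => -[_ /(_ a I)].
Qed.

(** As [fl] is constant, this is half the size of the symmetric difference of the two sections. *)
Let rho c c' := fl c - kap c c'.

Let kap_sym c c' : kap c c' = kap c' c.
Proof. by rewrite /kap /lam2; congr pinf; apply/funext => e; rewrite setIC. Qed.

Let rho_ge0 c c' : 0 <= rho c c'.
Proof.
rewrite subr_ge0; apply: le_pinf => e e0.
apply: (le_trans (pinf_le (lam2_ge0 _ _) e0)).
by apply: mean_ind_le.
Qed.

(** A point counted twice on the left lies in all three sets and is counted twice on the right. This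
    is the triangle inequality for symmetric differences. *)
Let lam_split (A B C : set T) :
  L (ind (A `&` B)) + L (ind (B `&` C)) <= L (ind B) + L (ind (A `&` C)).
Proof.
rewrite -!(meanD LP)//; apply: (mean_le LP) => [||t]; [exact: bnd_add..|].
rewrite /ind /setI /= !asbool_and.
by case: (`[< A t >]); case: (`[< B t >]); case: (`[< C t >]); rewrite /= ?mulr1n ?mulr0n; lra.
Qed.

Let rho_triangle a b c : rho a c <= rho a b + rho b c.
Proof.
suff : kap a b + kap b c <= fl b + kap a c.
  rewrite /rho (fl_cst a b); lra.
rewrite leNgt; apply/negP => h.
pose eta := (kap a b + kap b c - (fl b + kap a c)) / 2.
have eta0 : 0 < eta by rewrite divr_gt0// subr_gt0.
have [e1 e10 h1] : exists2 e, 0 < e & lam b e < fl b + eta.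
  by apply: pinf_lt => //; rewrite ltrDl.
have [e2 e20 h2] : exists2 e, 0 < e & lam2 a c e < kap a c + eta.
  by apply: pinf_lt => //; rewrite ltrDl.
pose e := Num.min e1 e2; have e0 : 0 < e by rewrite lt_min e10.
have := lam_split (E e a) (E e b) (E e c).
have : lam b e <= lam b e1 by apply: lam_mono; rewrite ge_min lexx.
have : lam2 a c e <= lam2 a c e2 by apply: lam2_mono; rewrite ge_min lexx orbT.
have := pinf_le (lam2_ge0 a b) e0; have := pinf_le (lam2_ge0 b c) e0.
move: h1 h2; rewrite -/(kap _ _) -/(kap _ _) -/(lam _ _) -/(lam2 _ _ _).
rewrite /eta /lam2 /lam; lra.
Qed.

(** For [x'] near [x], small neighbourhoods of both sections lie in [E e1 x], whose mean barely
    exceeds [fl x]. Two sets of mean at least [fl x] inside it must overlap almost entirely. *)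
Let rho_continuous x e : 0 < e ->
  exists2 e', 0 < e' & forall x', d x x' < e' -> rho x x' < e.
Proof.
move=> e0; have [e1 e10 h1] : exists2 e1, 0 < e1 & lam x e1 < fl x + e.
  by apply: pinf_lt => //; rewrite ltrDl.
exists (e1 / 2); first by rewrite divr_gt0.
move=> x' xx'.
suff : 2 * fl x - lam x e1 <= kap x x' by rewrite /rho; lra.
apply: le_pinf => e2 e20.
apply: (@le_trans _ _ (lam2 x x' (Num.min e2 (e1 / 2)))); last first.
  by apply: lam2_mono; rewrite ge_min lexx.
set e3 := Num.min _ _.
have e30 : 0 < e3 by rewrite lt_min e20 divr_gt0.
have := lam_split (E e3 x) (E e1 x) (E e3 x').
have sub1 : E e3 x `<=` E e1 x.
  by apply: E_mono; rewrite ge_min; apply/orP; right; lra.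
have sub2 : E e3 x' `<=` E e1 x.
  apply: (@subset_trans _ (E (e1 / 2) x')); first by apply: E_mono; rewrite ge_min lexx orbT.
  by have := @E_usc (e1 / 2) x x'; rewrite -splitr; apply => //; rewrite divr_gt0.
rewrite (setIidl sub1) (setIidr sub2).
have := pinf_le (lam_ge0 x) e30; have := pinf_le (lam_ge0 x') e30.
rewrite -/(fl x) -/(fl x') (fl_cst x' x) -/(lam _ _) -/(lam _ _) -/(lam _ _) -/(lam2 _ _ _).
rewrite /lam /lam2; lra.
Qed.

(* McMahon's argument: the measure of the symmetric difference of the sections
   [E c] is a continuous invariant pseudometric on [X]. *)
Lemma relative_mean_fiber c c' (A : set T) e : pi c = pi c' -> 0 < e ->
  (forall e', 0 < e' -> A `<=` E e' c) -> 0 < L (ind A) -> (A `&` E e c') !=set0.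
Proof.
move=> cc' e0 AE A0; apply: contrapT => nA.
have r0 : rho c c' = 0.
  apply: (invariant_pseudometric_fiber dX actP piP) => //.
  - by move=> x; rewrite /rho fl_kap subrr.
  - by move=> x y; rewrite /rho kap_sym (fl_cst x y).
  - by move=> g x y; rewrite /rho kap_act (fl_cst (act g x) x).
suff : fl c + L (ind A) <= fl c by rewrite gerDl leNgt A0.
(* At radii below [e], the set [A] and the intersection of the two sections are disjoint parts of
   the section over [c]. The intersection already has size [fl c], so nothing is left for [A]. *)
rewrite {2}/fl; apply: le_pinf => e1 e10.
have -> : fl c = kap c c' by apply/eqP; rewrite -subr_eq0 -/(rho c c') r0.
have e20 : 0 < Num.min e e1 by rewrite lt_min e0.
apply: (@le_trans _ _ (lam c (Num.min e e1))); last by apply: lam_mono; rewrite ge_min lexx orbT.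
apply: (@le_trans _ _ (lam2 c c' (Num.min e e1) + L (ind A))).
  by rewrite lerD2r; exact: pinf_le.
rewrite -(meanD LP)//; apply: (mean_le LP) => [||t]; [exact: bnd_add|by []|].
have [At|nAt] := pselect (A t); last by rewrite (indF nAt) addr0; apply: ind_sub => -[].
rewrite (indT (AE _ e20 _ At)) indF ?add0r ?ind_le1// => -[_ h].
by apply: nA; exists t; split=> //; apply: E_mono h; rewrite ge_min lexx.
Qed.

End relative_mean.

(** * Tuples over the fibres *)

Lemma common_radius {R : realType} {I : eqType} (s : seq I) (P : I -> R -> Prop) :
  (forall i e e', e <= e' -> P i e' -> P i e) ->
  (forall i, i \in s -> exists2 e, 0 < e & P i e) ->
  exists2 e, 0 < e & forall i, i \in s -> P i e.
Proof.
move=> Pm; elim: s => [|i s IH] h; first by exists 1.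
have [|e e0 he] := IH; first by move=> j js; apply: h; rewrite inE js orbT.
have [|e' e'0 he'] := h i; first by rewrite inE eqxx.
exists (Num.min e e'); first by rewrite lt_min e0.
move=> j; rewrite inE => /orP[/eqP->|/he].
  by apply: Pm he'; rewrite ge_min lexx orbT.
by apply: Pm; rewrite ge_min lexx.
Qed.

Lemma uniformly_continuous_metric {R : realType} {X Y : topologicalType}
    (d : X -> X -> R) (dY : Y -> Y -> R) (f : X -> Y) (e : R) :
  compact_metric_space d -> is_metric dY -> metric_induces_topology dY ->
  continuous f -> 0 < e ->
  exists2 e' : R, 0 < e' & forall x x', d x x' < e' -> dY (f x) (f x') < e.
Proof.
move=> [dM [dT cX]] eM eT fc e0; have e20 : 0 < e / 2 by rewrite divr_gt0.
have h x : exists r : R, 0 < r /\ forall x', d x x' < r -> dY (f x) (f x') < e / 2.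
  by have [r r0 hr] := (continuous_metricP f dM dT eM eT).1 fc x _ e20; exists r.
have [r hr] := choice h.
have [|x|s hs] := @compact_finite_subcover _ _ (fun x => mball d x (r x / 2)) cX.
- by move=> x; exact: open_mball.
- by exists x; apply: mball_center => //; rewrite divr_gt0//; case: (hr x).
have [||r' r'0 hr'] := @common_radius R _ s (fun x a => a <= r x / 2).
- by move=> i a b ab; exact: le_trans.
- by move=> x _; exists (r x / 2) => //; rewrite divr_gt0//; case: (hr x).
exists r' => // x x' xx'; have [y ys yx] := hs x; have [_ hy] := hr y.
have r1 := hr' y ys; rewrite /mball /= in yx.
have yx' := metric_triangle dM x y x'.
have ry : r y > 0 by case: (hr y).
have := hy x; have := hy x'.
move=> /(_ ltac:(lra)) a1 /(_ ltac:(lra)) a2.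
have := metric_triangle eM (f y) (f x) (f x'); rewrite (metric_sym eM (f x) (f y)); lra.
Qed.

Section fiber_tuples.
Context {R : realType} {G : groupType} {X Y : topologicalType}.
Context (d : X -> X -> R) (act : G -> X -> X).
Context (dY : Y -> Y -> R) (actY : G -> Y -> Y) (pi : X -> Y).
Hypotheses (dX : compact_metric_space d) (actP : is_action act).
Hypothesis act_min : minimal_system act.
Hypothesis piP : max_equicontinuous_factor act dY actY pi.
Context (M : (G -> R) -> R).
Hypothesis MP : is_mean M.
Hypothesis Minv : forall g f, bnd f -> M (fun x => f (g * x)%g) = M f.

(** Finitely many translates of the return set cover [G] and all have the same mean, so this mean
    cannot vanish. *)
Lemma mean_return_gt0 (O : set X) (z : X) : open O -> O !=set0 ->
  0 < M (ind [set g | O (act g z)]).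
Proof.
move=> oO nO; have [dM [dT cX]] := dX.
have [s hs] := minimal_syndetic actP act_min cX oO nO.
set A := [set g | O (act g z)]; rewrite lt_neqAle mean_ind_ge0// andbT eq_sym.
apply/eqP => A0.
have bA g : bnd (fun h => ind A (g * h)%g : R) by exact: (bnd_comp (fun h => (g * h)%g)).
have [bS MS] := mean_sum MP s bA.
have : 1 <= M (fun h => \sum_(g <- s) ind A (g * h)%g).
  rewrite -(mean1 MP); apply: (mean_le MP) => // h.
  have [g gs Og] := hs (act h z).
  rewrite (big_rem g)//= indT ?lerDl; last by rewrite /A /= actM.
  by apply: sumr_ge0 => i _; exact: ind_ge0.
rewrite MS big1 ?ler10// => g _.
by rewrite (Minv g (bnd_ind A)) A0.
Qed.

(** McMahon's argument with [T] the lists over [G] and [L] the product mean: a list [s] encodes the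
    coordinates [s_i z] other than the [j]-th. Its section relation holds when this tuple, with [x]
    at place [j], is near the orbit of the box of the [S i]. *)
Lemma replace_coordinate n j (S : nat -> set X) (p : nat -> X) (c : X) (r : R) :
  (j < n)%N -> (forall i, (i < n)%N -> open (S i)) ->
  (forall i, (i < n)%N -> i != j -> S i (p i)) ->
  S j c -> pi c = pi (p j) -> 0 < r ->
  exists h w, forall i, (i < n)%N -> S i (w i) /\ d (p i) (act h (w i)) < r.
Proof.
move=> jn oS Sp Sc cp r0; have [dM [dT cX]] := dX; pose z := c.
pose E (e : R) (x : X) : set (seq G) := [set s | exists h w, [/\
  forall i, (i < n)%N -> S i (w i), d x (act h (w j)) < e &
  forall i, (i < size s)%N -> (i < n)%N -> i != j ->
    d (act (nth 1%g s i) z) (act h (w i)) < e]].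
(* The [j]-th entry of the list is a dummy and is left unconstrained. *)
pose O i := if (i < n)%N && (i != j) then mball d (p i) (r / 2) `&` S i else setT.
have r20 : 0 < r / 2 by rewrite divr_gt0.
have oO i : open (O i).
  rewrite /O; case: ifP => [/andP[iN _]|_]; last exact: openT.
  by apply: openI; [exact: open_mball|exact: oS].
have nO i : O i !=set0.
  rewrite /O; case: ifP => [/andP[iN ij]|_]; last by exists z.
  by exists (p i); split; [exact: mball_center|exact: Sp].
pose A : set (seq G) := [set s | size s = n /\
  forall i, (i < size s)%N -> O i (act (nth 1%g s i) z)].
have A0 : 0 < mean_iter M n (ind A).
  have := @mean_iter_box_gt0 R G M MP n (fun i => [set g | O i (act g z)]).
  move=> /(_ (fun i => mean_return_gt0 z (oO i) (nO i))).
  congr (_ < _); apply: eq_mean_iter => s sn; rewrite /ind; congr ((nat_of_bool _)%:R).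
  by apply: asbool_equiv_eq; rewrite /A /=; split=> [h|[_ h]].
have [|||||s [[sn Os] [h [w [Sw jw iw]]]]] :=
  @relative_mean_fiber R G X Y d act dY actY pi dX actP act_min piP (seq G)
  (mean_iter M n) (fun g => map (fun h => (g * h)%g)) E
  (mean_iter_is_mean MP n) _ _ _ _ c (p j) A (r / 2) cp r20 _ A0.
- by move=> g f bf; exact: mean_iter_shift.
- move=> e e' x ee' s [h [w [h1 h2 h3]]]; exists h, w; split=> //.
    exact: lt_le_trans ee'.
  by move=> i *; apply: lt_le_trans ee'; exact: h3.
- move=> e x x' e0 xx' s [h [w [h1 h2 h3]]]; exists h, w; split=> //.
    by apply: (le_lt_trans (metric_triangle dM x' _ _)); rewrite ltrD.
  move=> i *; apply: (@lt_trans _ _ e); [exact: h3|by rewrite ltrDl].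
- move=> g e e0.
  have [e' e'0 he'] := uniformly_continuous_metric dX dM dT (@act_continuous _ _ act actP g) e0.
  exists e' => // x s [h [w [h1 h2 h3]]]; exists (g * h)%g, w; split=> //.
    by rewrite actM//; exact: he'.
  move=> i; rewrite size_map => is_ iN ij; rewrite (nth_map 1%g)// !actM//.
  by apply: he'; exact: h3.
- move=> e e0 s [sn Os]; exists 1%g, (fun i => if i == j then c else act (nth 1%g s i) z).
  split.
  + move=> i iN; case: eqP => [->//|/eqP ij].
    by have := Os i; rewrite sn /O iN ij /= => /(_ isT)[].
  + by rewrite eqxx act1// metric_refl.
  + by move=> i _ iN /negbTE ->; rewrite act1// metric_refl.
exists h, w => i iN; split; first exact: Sw.
have [->|ij] := eqVneq i j; first by apply: (lt_le_trans jw); lra.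
have := Os i; rewrite sn /O iN ij /= => /(_ isT)[+ _].
have := iw i; rewrite sn => /(_ iN iN ij).
have := metric_triangle dM (act (nth 1%g s i) z) (p i) (act h (w i)).
rewrite /mball /=; lra.
Qed.

(* The coordinates of a point over [\prod_i B i] are brought into the [W i] one at
   a time. *)
Lemma fiber_tuple_return n (W : nat -> set X) (B : nat -> set Y) (p : nat -> X) (r : R) :
  (forall i, (i < n)%N -> open (W i)) -> (forall i, (i < n)%N -> open (B i)) ->
  (forall i, (i < n)%N -> B i `<=` pi @` W i) ->
  (forall i, (i < n)%N -> B i (pi (p i))) -> 0 < r ->
  exists h w, forall i, (i < n)%N -> W i (w i) /\ d (p i) (act h (w i)) < r.
Proof.
move=> oW oB BW Bp; have [dM [dT cX]] := dX.
(* [S k] still lets the first [k] coordinates range over the whole preimages of the [B i]; [S 0] is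
   the box of the [W i]. *)
pose S k i := if (i < k)%N then pi @^-1` B i else W i.
have pic : continuous pi by have [_ [_ [_ [[]]]]] := piP.
suff H k q : (k <= n)%N -> (forall i, (i < n)%N -> S k i (q i)) -> forall r, 0 < r ->
    exists h w, forall i, (i < n)%N -> W i (w i) /\ d (q i) (act h (w i)) < r.
  by apply: (H n) => // i iN; rewrite /S iN; exact: Bp.
elim: k q => [|k IH] q kn Sq {r} r r0.
  by exists 1%g, q => i iN; rewrite act1// metric_refl//; split=> //; exact: Sq.
have r20 : 0 < r / 2 by rewrite divr_gt0.
have [c Wc cq] : (pi @` W k) (pi (q k)).
  by apply: BW => //; have := Sq k kn; rewrite /S ltnSn.
have [|||h [w hw]] := @replace_coordinate n k (S k) q c (r / 2) kn _ _ _ cq r20.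
- move=> i iN; rewrite /S; case: ifP => ik; last exact: oW.
  by apply: open_comp; [move=> x _; exact: pic|exact: oB].
- move=> i iN ik; have := Sq i iN; rewrite /S ltnS leq_eqVlt (negbTE ik) /=.
  by case: ifP.
- by rewrite /S ltnn.
(* The intermediate tuple [w] must be approximated finely enough for [h] to preserve the error
   [r / 2]. *)
have [e e0 he] := uniformly_continuous_metric dX dM dT (@act_continuous _ _ act actP h) r20.
have [|h' [w' hw']] := IH w (ltnW kn) _ e e0.
  by move=> i iN; case: (hw i iN).
exists (h * h')%g, w' => i iN; have [Ww ww] := hw' i iN; split=> //.
have [_] := hw i iN; have := he _ _ ww.
have := metric_triangle dM (act h (w i)) (q i) (act (h * h')%g (w' i)).
rewrite actM//; lra.
Qed.

Lemma fiber_family_return (I : finType) (W O : I -> set X) (B : I -> set Y) (p : I -> X) :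
  (forall i, open (W i)) -> (forall i, open (B i)) ->
  (forall i, B i `<=` pi @` W i) -> (forall i, B i (pi (p i))) ->
  (forall i, open (O i)) -> (forall i, O i (p i)) ->
  exists h, forall i, exists2 w, W i w & O i (act h w).
Proof.
move=> oW oB BW Bp oO Op; have [dM [dT cX]] := dX.
have [i0 _|noI] := pickP I; last by exists 1%g => i; have := noI i.
have [||r r0 hr] := @common_radius R _ (enum I) (fun i e => mball d (p i) e `<=` O i).
- by move=> i e e' ee' h; apply: subset_trans h => x /= /lt_le_trans; apply.
- by move=> i _; exact: open_mballP.
pose en k := nth i0 (enum I) k.
have [|||||h [w hw]] := @fiber_tuple_return #|I| (W \o en) (B \o en) (p \o en) r.
- by move=> k _; exact: oW.
- by move=> k _; exact: oB.
- by move=> k _; exact: BW.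
- by move=> k _; exact: Bp.
- by [].
exists h => i; have [|Ww dw] := hw (index i (enum I)).
  by rewrite cardE index_mem mem_enum.
have E : en (index i (enum I)) = i by rewrite /en nth_index// mem_enum.
rewrite /= E in Ww dw; exists (w (index i (enum I))) => //.
by apply: hr => //; rewrite mem_enum.
Qed.

End fiber_tuples.

(** * Unique ergodicity *)

Definition pr {R : realType} {Y : ptopologicalType}
    (nu : probability (borel_type Y) R) (A : set Y) : R :=
  fine (nu (A : set (borel_type Y))).

Section probability_on_borel_sets.
Context {R : realType} {Y : ptopologicalType} (nu : probability (borel_type Y) R).
Notation bmeas A := (measurable (A : set (borel_type Y))).

Lemma open_borel (A : set Y) : open A -> bmeas A.
Proof. by move=> oA; exact: sub_sigma_algebra. Qed.

Lemma closed_borel (A : set Y) : closed A -> bmeas A.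
Proof. 
move=> cA; rewrite -(setCK A); apply: measurableC.
by apply: open_borel; exact: closed_openC.
 Qed.

Lemma prE (A : set Y) : bmeas A -> nu A = (pr nu A)%:E.
Proof. by move=> mA; rewrite /pr fineK//; exact: fin_num_measure. Qed.

Lemma pr_ge0 (A : set Y) : 0 <= pr nu A.
Proof. by rewrite /pr fine_ge0// measure_ge0. Qed.

Lemma pr_le (A B : set Y) : bmeas A -> bmeas B -> A `<=` B -> pr nu A <= pr nu B.
Proof.
by move=> mA mB AB; rewrite -lee_fin -!prE//; apply: le_measure => //; exact/mem_set.
Qed.

Lemma prT : pr nu setT = 1.
Proof. by rewrite /pr probability_setT. Qed.

Lemma pr_le1 (A : set Y) : bmeas A -> pr nu A <= 1.
Proof. by move=> mA; rewrite -prT; exact: pr_le. Qed.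

Lemma prC (A : set Y) : bmeas A -> pr nu (~` A) = 1 - pr nu A.
Proof.
move=> mA; have : nu (~` A) = (1 - nu A)%E by exact: probability_setC.
by rewrite (prE mA) (prE (measurableC mA)) => -[].
Qed.

Lemma pr0 : pr nu set0 = 0. Proof. by rewrite /pr measure0. Qed.

Lemma prD (A B : set Y) : bmeas A -> bmeas B -> B `<=` A ->
  pr nu (A `\` B) = pr nu A - pr nu B.
Proof.
move=> mA mB BA; have : nu A = (nu (A `\` B) + nu B)%E.
  rewrite -measureU ?setDKU//; first exact: measurableD.
  by rewrite setDE -setIA setICl setI0.
rewrite (prE mA) (prE mB) (prE (measurableD mA mB)).
by rewrite -EFinD => -[->]; rewrite addrK.
Qed.

Lemma pr_lim (A : nat -> set Y) (e : R) : (forall n, bmeas (A n)) ->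
  (forall n, A n.+1 `<=` A n) -> 0 < e ->
  exists n, pr nu (A n) < pr nu (\bigcap_n A n) + e.
Proof.
move=> mA dA e0.
have mI : bmeas (\bigcap_n A n) by exact: bigcap_measurable.
have A0 : (nu (A 0%N) < +oo)%E by rewrite prE// ltry.
have nA : nonincreasing_seq (A : nat -> set (borel_type Y)).
  by apply/nonincreasing_seqP => n; apply/asboolP; exact: dA.
have h : (fun n => nu (A n)) @ \oo --> (pr nu (\bigcap_n A n))%:E.
  rewrite -prE//.
  exact: (@nonincreasing_cvg_mu _ (borel_type Y) R nu A A0 mA mI nA).
have /fine_cvgP[_] := h.
move=> /cvgrPdist_lt /(_ e e0)[n _ /(_ n (leqnn n))] /=.
rewrite ltr_norml -/(pr nu (A n)) => /andP[h1 _]; exists n; lra.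
Qed.

(** The counting function of the [A i] is at most [k] times the indicator of [O]; integrate. *)
Lemma sum_pr_le (I : Type) (s : seq I) (A : I -> set Y) (O : set Y) (k : R) :
  (forall i, bmeas (A i)) -> bmeas O -> (forall i, A i `<=` O) ->
  (forall y, \sum_(i <- s) ind (A i) y <= k) ->
  \sum_(i <- s) pr nu (A i) <= k * pr nu O.
Proof.
move=> mA mO AO hk.
have k0 : 0 <= k.
  by apply: le_trans (hk point); apply: sumr_ge0 => i _; exact: ind_ge0.
have indE (B : set Y) y : ind B y = \1_B y :> R.
  by rewrite indicE /ind; congr ((nat_of_bool _)%:R); apply/asboolP/idP; rewrite inE.
rewrite -lee_fin EFinM -prE// -sumEFin.
have -> : (\sum_(i <- s) (pr nu (A i))%:E = \int[nu]_x (\sum_(i <- s) (\1_(A i) x : R)%:E))%E.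
  rewrite ge0_integral_sum//; last by move=> i; apply/measurable_EFinP; exact: measurable_indic.
  by apply: eq_bigr => i _; rewrite integral_indic// setIT; exact/esym/prE.
have -> : (k%:E * nu O = \int[nu]_x (k%:E * (\1_O x : R)%:E))%E.
  rewrite ge0_integralZl//.
  - by rewrite integral_indic// setIT.
  - by apply/measurable_EFinP; exact: measurable_indic.
apply: ge0_le_integral => //.
- by move=> x _; apply: sume_ge0 => i _; rewrite lee_fin.
- by apply: emeasurable_sum => i; apply/measurable_EFinP; exact: measurable_indic.
- by apply: measurable_funeM; apply/measurable_EFinP; exact: measurable_indic.
move=> x _; rewrite sumEFin -EFinM lee_fin.
under eq_bigr do rewrite -indE.
have [Ox|nOx] := pselect (O x); first by rewrite -indE indT// mulr1.
rewrite -indE indF// mulr0 big1// => i _.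
by rewrite indF// => /AO.
Qed.

Lemma sum_pr_ge (I : Type) (s : seq I) (A : I -> set Y) (k : R) :
  (forall i, bmeas (A i)) -> (forall y, k <= \sum_(i <- s) ind (A i) y) ->
  k <= \sum_(i <- s) pr nu (A i).
Proof.
move=> mA hk.
suff : \sum_(i <- s) pr nu (~` A i) <= ((size s)%:R - k) * pr nu setT.
  under eq_bigr do rewrite prC//.
  by rewrite prT mulr1 sumrB big_const_seq count_predT iter_addr addr0 lerD2l lerN2.
apply: sum_pr_le => // [i|y]; first exact: measurableC.
have := hk y; rewrite lerBrDr => /(lerD (lexx (\sum_(i <- s) ind (~` A i) y))).
move=> /le_trans; apply; rewrite -big_split/= -[in leRHS](count_predT s) countE.
apply: ler_sum => i _; have [Ay|nAy] := pselect (A i y).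
  by rewrite (indT Ay) indF ?add0r// => /(_ Ay).
by rewrite (indF nAy) addr0 ind_le1.
Qed.

End probability_on_borel_sets.

(** * Thickenings of closed sets and frequencies of visits *)

Definition thick {R : realType} {Y : Type} (rho : Y -> Y -> R) (C : set Y) (e : R)
  : set Y := [set y | exists2 c, C c & rho c y < e].

Lemma inv_natS_lt {R : realType} (e : R) : 0 < e -> exists n : nat, n.+1%:R^-1 < e.
Proof.
move=> e0; exists (Num.truncn e^-1); rewrite invf_plt ?posrE//.
exact: truncnS_gt.
Qed.

Lemma inv_natS_le {R : realType} n : n.+2%:R^-1 <= n.+1%:R^-1 :> R.
Proof. by rewrite lef_pV2 ?posrE// ler_nat. Qed.

Section thickening.
Context {R : realType} {Y : topologicalType} (rho : Y -> Y -> R).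
Hypotheses (rM : is_metric rho) (rT : metric_induces_topology rho).

Lemma open_thick C e : open (thick rho C e).
Proof.
rewrite (_ : thick rho C e = \bigcup_(c in C) mball rho c e).
  by apply: bigcup_open => c _; exact: open_mball.
by apply/seteqP; split=> [y [c Cc cy]|y [c Cc cy]]; exists c.
Qed.

Lemma sub_thick C e : 0 < e -> C `<=` thick rho C e.
Proof. by move=> e0 y Cy; exists y => //; rewrite metric_refl. Qed.

Lemma thick_le C e e' : e <= e' -> thick rho C e `<=` thick rho C e'.
Proof. by move=> ee' y [c Cc cy]; exists c => //; exact: lt_le_trans ee'. Qed.

Lemma thick_shift C e e' y y' : thick rho C e y -> rho y y' < e' ->
  thick rho C (e + e') y'.
Proof.
move=> [c Cc cy] yy'; exists c => //.
by rewrite (le_lt_trans (metric_triangle rM y _ _))// ltrD.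
Qed.

Lemma closure_thick C e e' : 0 < e' -> closure (thick rho C e) `<=` thick rho C (e + e').
Proof.
move=> e'0 y /(closure_metricP rM rT) /(_ _ e'0)[z Cz yz].
by apply: (thick_shift Cz); rewrite metric_sym.
Qed.

Lemma bigcap_thick C : closed C -> \bigcap_n thick rho C n.+1%:R^-1 = C.
Proof.
move=> cC; apply/seteqP; split=> [y h|y Cy n _]; last exact: sub_thick.
rewrite (closure_id C).1//; apply/(closure_metricP rM rT) => e e0.
have [n ne] := inv_natS_lt e0; have [c Cc cy] := h n I.
by exists c => //; rewrite metric_sym//; exact: lt_trans ne.
Qed.

End thickening.

Section unique_ergodicity.
Context {R : realType} {G : groupType} {Y : ptopologicalType}.
Context (rho : Y -> Y -> R) (actY : G -> Y -> Y).
Hypotheses (rY : compact_metric_space rho) (actYP : is_action actY).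
Hypothesis actY_min : minimal_system actY.
Hypothesis rho_inv : forall g y y', rho (actY g y) (actY g y') = rho y y'.
Context (nu : probability (borel_type Y) R).
Hypothesis nu_inv : forall (g : G) (A : set (borel_type Y)),
  measurable A -> nu (actY g @^-1` A) = nu A.

Let rM : is_metric rho. Proof. by case: rY. Qed.
Let rT : metric_induces_topology rho. Proof. by case: rY => _ []. Qed.
Let cY : compact [set: Y]. Proof. by case: rY => _ []. Qed.

Lemma pr_act g (A : set Y) : measurable (A : set (borel_type Y)) ->
  pr nu (actY g @^-1` A) = pr nu A.
Proof. by move=> mA; rewrite /pr nu_inv. Qed.

Lemma pr_thick C e : closed C -> 0 < e ->
  exists2 e', 0 < e' & pr nu (thick rho C e') < pr nu C + e.
Proof.
move=> cC e0.
have [n|n y|n] := @pr_lim R Y nu (fun n => thick rho C n.+1%:R^-1) e _ _ e0.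
- by apply: open_borel; exact: open_thick.
- by apply: thick_le; exact: inv_natS_le.
- by rewrite bigcap_thick// => h; exists n.+1%:R^-1.
Qed.

(** Finitely many preimages of [O], all of the same measure, cover [Y]. *)
Lemma open_pr_gt0 (O : set Y) : open O -> O !=set0 -> 0 < pr nu O.
Proof.
move=> oO nO; have [s hs] := minimal_syndetic actYP actY_min cY oO nO.
rewrite lt_neqAle pr_ge0 andbT eq_sym; apply/eqP => O0.
have : 1 <= \sum_(g <- s) pr nu (actY g @^-1` O).
  apply: sum_pr_ge => [g|y]; first by apply: open_borel; exact: open_act_preimage.
  have [g gs Og] := hs y; rewrite (big_rem g)//= indT// lerDl.
  by apply: sumr_ge0 => i _; exact: ind_ge0.
rewrite big1 ?ler10// => g _; rewrite pr_act//; exact: open_borel.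
Qed.

Let cb y (r : R) : set Y := [set z | rho y z <= r].

Let closed_cb y r : closed (cb y r).
Proof.
rewrite -[X in closed X]setCK; apply: open_closedC; apply/rT => z /= /negP.
rewrite -ltNge => yz; exists (rho y z - r); first by rewrite subr_gt0.
move=> w /= zw; apply/negP; rewrite -ltNge.
have := metric_triangle rM w y z; rewrite (metric_sym rM w z); lra.
Qed.

Let pr_cb g y r : pr nu (cb (actY g y) r) = pr nu (cb y r).
Proof.
rewrite -(pr_act g); last by apply: closed_borel; exact: closed_cb.
by congr pr; apply/seteqP; split=> z; rewrite /cb /= rho_inv.
Qed.

Let pr_cb_right y r e : 0 < e ->
  exists2 e', 0 < e' & pr nu (cb y (r + e')) < pr nu (cb y r) + e.
Proof.
move=> e0.
have [n|n z|n] := @pr_lim R Y nu (fun n => cb y (r + n.+1%:R^-1)) e _ _ e0.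
- by apply: closed_borel; exact: closed_cb.
- by move=> /le_trans; apply; rewrite lerD2l; exact: inv_natS_le.
- rewrite (_ : \bigcap_n _ = cb y r) => [h|]; first by exists n.+1%:R^-1.
  apply/seteqP; split=> [z h|z h k _]; last first.
    by apply: (le_trans h); rewrite lerDl.
  rewrite /cb /= leNgt; apply/negP => rz.
  have [k] := @inv_natS_lt R (rho y z - r) ltac:(lra).
  have hk := h k I; rewrite /cb /= in hk; move: hk; set u := (_^-1); lra.
Qed.

Context (F : nat -> seq G).
Hypothesis FP : Folner_seq (R := R) F.

Let sd g n : R := (symdiff_size (map (fun h => (g * h)%g) (F n)) (F n))%:R.

Let near_sd (s : seq G) (e : R) : 0 < e ->
  \forall n \near \oo, forall g, g \in s -> sd g n <= e * (size (F n))%:R.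
Proof.
move=> e0; elim: s => [|g s IH]; first by apply: nearW.
have : \forall n \near \oo, sd g n <= e * (size (F n))%:R.
  have /cvgrPdist_lt /(_ e e0) := FP.2 g; apply: filterS => n.
  rewrite sub0r normrN ger0_norm; last by rewrite divr_ge0.
  by move=> /ltW; rewrite ler_pdivrMr// (folner_size_gt0 FP).
by apply: filterS2 IH => n IHn h g'; rewrite inE => /orP[/eqP->//|/IHn].
Qed.

(* Double counting of the pairs [(g, y)] with [g \in F n] and [y] in the closed ball of
   radius [r] around [g y0]; almost invariance of [F n] makes the number of such
   [g] nearly independent of [y]. *)
Lemma folner_frequency_le (y0 : Y) (C : set Y) (eta : R) : closed C -> 0 < eta ->
  \forall n \near \oo,
    favg F (ind [set g | C (actY g y0)]) n <= pr nu C + eta.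
Proof.
move=> cC eta0.
have [e e0 he] := pr_thick cC (divr_gt0 eta0 (ltr0Sn R 1)).
pose r := e / 2; have r0 : 0 < r by rewrite divr_gt0.
pose v := pr nu (cb y0 r).
have v0 : 0 < v.
  apply: (@lt_le_trans _ _ (pr nu (mball rho y0 r))).
    by apply: open_pr_gt0; [exact: open_mball|exists y0; exact: mball_center].
  apply: pr_le; [by apply: open_borel; exact: open_mball|
    by apply: closed_borel; exact: closed_cb|by move=> z /ltW].
have tau0 : 0 < eta * v / 4 by rewrite divr_gt0// mulr_gt0.
have [e1 e10 he1] := pr_cb_right y0 r tau0.
(* Every [y] is moved to within [ep] of [y0] by some element of a fixed list [s]; going there and
   back costs [ep + ep = e1] in the radius. *)
pose ep := e1 / 2; have ep0 : 0 < ep by rewrite divr_gt0.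
have [s hs] := minimal_syndetic actYP actY_min cY (open_mball rM rT y0 ep)
  (ex_intro _ y0 (mball_center rM y0 ep0)).
have := @near_sd s (eta * v / 8) ltac:(by rewrite divr_gt0// mulr_gt0).
apply: filterS => n hsd; set Fn := F n in hsd *.
have Fn0 : 0 < (size Fn)%:R :> R by exact: folner_size_gt0.
pose S : R := (size Fn)%:R.
pose sig := eta * v / 8 * S; rewrite -/S -/sig in hsd Fn0.
(* The reference count [a] concerns [y0] alone; [upper] and [lower] compare every other [y] with it
   through a shift by [g]. *)
pose f : G -> R := ind [set h | cb y0 (r + ep) (actY h y0)].
pose a := \sum_(g <- Fn) f g.
have shift g : g \in s -> `|\sum_(h <- Fn) f (g * h)%g - a| <= sig.
  move=> gs; apply: le_trans (hsd g gs); rewrite -[leRHS]mul1r.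
  apply: (folner_shift FP) => x.
  by rewrite ger0_norm ?ind_ge0// ind_le1.
have upper y : \sum_(g <- Fn) ind (cb (actY g y0) r) y <= a + sig.
  have [g gs gy] := hs y; have := shift g gs; rewrite ler_norml => /andP[_].
  suff : \sum_(h <- Fn) ind (cb (actY h y0) r) y <= \sum_(h <- Fn) f (g * h)%g by lra.
  apply: ler_sum => h _.
  apply: (@ind_sub R _ (fun=> cb (actY h y0) r y) (fun=> cb y0 (r + ep) (actY (g * h)%g y0)) tt).
  rewrite /cb /mball /= actM// in gy * => hy.
  have := metric_triangle rM (actY g y) y0 (actY g (actY h y0)).
  rewrite rho_inv (metric_sym rM y); lra.
have lower y : a - sig <= \sum_(g <- Fn) ind (cb (actY g y0) (r + e1)) y.
  have [g gs gy] := hs y; have := shift g gs; rewrite ler_norml => /andP[+ _].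
  suff : \sum_(h <- Fn) f (g * h)%g <= \sum_(h <- Fn) ind (cb (actY h y0) (r + e1)) y by lra.
  apply: ler_sum => h _.
  apply: (@ind_sub R _ (fun=> cb y0 (r + ep) (actY (g * h)%g y0))
    (fun=> cb (actY h y0) (r + e1) y) tt).
  rewrite /cb /mball /= actM// in gy * => hy.
  have := metric_triangle rM y0 (actY g y) (actY g (actY h y0)).
  rewrite rho_inv (metric_sym rM (actY h y0)) (metric_sym rM (actY g y) y0).
  have : ep + ep = e1 by rewrite -splitr.
  lra.
have a_le : a - sig <= S * pr nu (cb y0 (r + e1)).
  have mcb g : measurable (cb (actY g y0) (r + e1) : set (borel_type Y)).
    by apply: closed_borel; exact: closed_cb.
  have := sum_pr_ge nu mcb lower.
  by under eq_bigr do rewrite pr_cb; rewrite big_const_seq count_predT iter_addr addr0 -mulr_natl.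
pose A g : set Y := [set y | C (actY g y0) /\ cb (actY g y0) r y].
have AE g : C (actY g y0) -> A g = cb (actY g y0) r.
  by move=> Cg; apply/seteqP; split=> [y []|y].
have An g : ~ C (actY g y0) -> A g = set0 by move=> Cg; apply/seteqP; split=> [y []|y].
pose N : R := \sum_(g <- Fn) ind [set g | C (actY g y0)] g.
have P1 : pr nu (thick rho C e) <= 1 by apply: pr_le1; apply: open_borel; exact: open_thick.
(* Only the balls centred at visits to [C] are kept. There are [N] of them, each of measure [v], all
   inside the thickening of [C]. *)
have N_le : N * v <= (a + sig) * pr nu (thick rho C e).
  have <- : \sum_(g <- Fn) pr nu (A g) = N * v.
    rewrite mulr_suml; apply: eq_bigr => g _.
    have [Cg|nCg] := pselect (C (actY g y0)); first by rewrite AE// indT// mul1r pr_cb.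
    by rewrite An// indF// mul0r pr0.
  apply: sum_pr_le => [g||g y [Cg gy]|y].
  - have [Cg|nCg] := pselect (C (actY g y0)); last by rewrite An.
    by rewrite AE//; apply: closed_borel; exact: closed_cb.
  - by apply: open_borel; exact: open_thick.
  - by exists (actY g y0) => //; apply: (le_lt_trans gy); rewrite /r; lra.
  - by apply: le_trans (upper y); apply: ler_sum => g _; apply: ind_sub => -[].
rewrite /favg -/N -/S ler_pdivrMr//.
have P0 := pr_ge0 nu (thick rho C e).
rewrite -(ler_pM2r v0); apply: (le_trans N_le).
set P := pr nu (thick rho C e) in he P1 P0 *; set C0 := pr nu C in he *.
set v1 := pr nu (cb y0 (r + e1)) in he1 a_le.
apply: (@le_trans _ _ ((S * (v + eta * v / 4) + 2 * sig) * P)).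
  apply: ler_wpM2r => //; have : S * v1 <= S * (v + eta * v / 4).
    by rewrite ler_pM2l// ltW.
  by move: a_le; lra.
(* The error in the ball volume and the two shift errors each contribute [eta / 4]; the remaining
   [eta / 2] pays for the thickening. *)
have -> : (S * (v + eta * v / 4) + 2 * sig) * P = S * v * (P + P * (eta / 2)).
  by rewrite /sig; lra.
rewrite [leRHS](_ : _ = S * v * (C0 + eta)); last by lra.
rewrite ler_pM2l ?mulr_gt0//.
have : P * (eta / 2) <= 1 * (eta / 2) by apply: ler_wpM2r => //; rewrite divr_ge0// ltW.
rewrite -/C0 in he; lra.
Qed.

End unique_ergodicity.

(** * Weakly mean-sensitive tuples *)

Section banach_density.
Context {R : realType} {G : groupType}.

Lemma favg_ind (F : nat -> seq G) (A : set G) n :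
  favg F (ind A) n = (count (fun g => `[< A g >]) (F n))%:R / (size (F n))%:R :> R.
Proof. by rewrite /favg countE. Qed.

Lemma upper_BD_le (A : set G) (c : R) :
  (forall F : nat -> seq G, Folner_seq (R := R) F ->
     \forall n \near \oo, favg F (ind A) n <= c) ->
  (upper_BD A <= c%:E)%E.
Proof.
move=> h; apply: ge_ereal_sup => _ [F [FP ->]].
rewrite /limn_esup limf_esupE.
set u := fun n : nat => _.
apply: (@le_trans _ _ (ereal_sup (u @` [set n | favg F (ind A) n <= c]))).
  by apply: ereal_inf_lbound; exists [set n | favg F (ind A) n <= c] => //; exact: h.
by apply: ge_ereal_sup => _ [n /= hn <-]; rewrite /u lee_fin -favg_ind.
Qed.

Lemma upper_BD_ge (A : set G) (c : R) (F : nat -> seq G) : Folner_seq (R := R) F ->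
  (forall n, c <= favg F (ind A) n) -> (c%:E <= upper_BD A)%E.
Proof.
move=> FP h.
set u := fun n => ((count (fun g => `[< A g >]) (F n))%:R / (size (F n))%:R : R)%:E.
apply: (@le_trans _ _ (limn_esup u)); last by apply: ereal_sup_ubound; exists F.
rewrite /limn_esup limf_esupE; apply: le_ereal_inf_tmp => _ [B [n _ nB] <-].
apply: (@le_trans _ _ (u n)); first by rewrite /u lee_fin -favg_ind.
by apply: ereal_sup_ubound; exists n => //; exact: nB (leqnn n).
Qed.

Lemma symdiff_size_map {T T' : eqType} (f : T -> T') (s t : seq T) : injective f ->
  symdiff_size (map f s) (map f t) = symdiff_size s t.
Proof.
move=> fi; rewrite /symdiff_size !count_map.
by congr (_ + _)%N; apply: eq_count => x /=; rewrite mem_map.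
Qed.

(** Right translations commute with the left translations of the Følner condition, so [t n] may vary
    freely with [n]. *)
Lemma folner_right_translate (F : nat -> seq G) (t : nat -> G) :
  Folner_seq (R := R) F -> Folner_seq (R := R) (fun n => map (fun g => (g * t n)%g) (F n)).
Proof.
move=> [F1 F2]; have inj n : injective (fun g => g * t n)%g by exact: mulIg.
split=> [n|g].
  by have [uF nF] := F1 n; rewrite map_inj_uniq//; split=> //; case: (F n) nF.
have := F2 g; set u := fun n : nat => _; set v := fun n : nat => _.
suff -> : u = v by [].
apply/funext => n; rewrite /u /v size_map -map_comp -(symdiff_size_map _ _ (inj n)) -map_comp.
by congr ((symdiff_size _ _)%:R / _); apply: eq_map => h /=; rewrite mulgA.
Qed.

End banach_density.

Section weakly_mean_sensitive.
Context {R : realType} {G : groupType} {X : topologicalType} {Y : ptopologicalType}.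
Context (d : X -> X -> R) (act : G -> X -> X).
Context (dY : Y -> Y -> R) (actY : G -> Y -> Y) (pi : X -> Y).
Hypotheses (dX : compact_metric_space d) (actP : is_action act).
Hypothesis act_min : minimal_system act.
Hypothesis piP : max_equicontinuous_factor act dY actY pi.
Context (rho : Y -> Y -> R).
Hypothesis rY : compact_metric_space rho.
Hypothesis rho_inv : forall g y y', rho (actY g y) (actY g y') = rho y y'.
Context (nu : probability (borel_type Y) R).
Hypothesis nu_inv : forall (g : G) (A : set (borel_type Y)),
  measurable A -> nu (actY g @^-1` A) = nu A.

Let dM : is_metric d. Proof. by case: dX. Qed.
Let dT : metric_induces_topology d. Proof. by case: dX => _ []. Qed.
Let rM : is_metric rho. Proof. by case: rY. Qed.
Let rT : metric_induces_topology rho. Proof. by case: rY => _ []. Qed.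
Let actYP : is_action actY. Proof. by case: piP => _ []. Qed.
Let piF : factor_map act actY pi. Proof. by case: piP => _ [_ [_ []]]. Qed.
Let pic : continuous pi. Proof. by case: piF. Qed.
Let pis y : exists x, pi x = y. Proof. by case: piF => _ []. Qed.
Let pie g x : pi (act g x) = actY g (pi x). Proof. by case: piF => _ []. Qed.
Let Yhaus : hausdorff_space Y. Proof. exact: (metric_hausdorff rM rT). Qed.
Let actY_min : minimal_system actY. Proof. exact: factor_minimal piF. Qed.

Lemma closed_pi_closure (A : set X) : closed (pi @` closure A).
Proof. by apply: (closed_factor_image dX Yhaus piF); exact: closed_closure. Qed.

Lemma closed_pi_closures (I : Type) (U : I -> set X) :
  closed (\bigcap_k (pi @` closure (U k))).
Proof. by apply: closed_bigI => k _; exact: closed_pi_closure. Qed.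

Lemma bigcap_closure_thick (A : set Y) : closed A ->
  \bigcap_n closure (thick rho A n.+1%:R^-1) = A.
Proof.
move=> cA; rewrite -[RHS](bigcap_thick rM rT cA); apply/seteqP; split=> y h n _.
  have := h n.+1 I; move=> /(closure_thick rM rT) h'.
  have e1 : 0 < n.+1%:R^-1 - n.+2%:R^-1 :> R.
    by rewrite subr_gt0 ltf_pV2 ?posrE// ltr_nat.
  by have := h' _ e1; rewrite addrC subrK.
by apply: subset_closure; exact: h.
Qed.

(** If the measure were 0, some thickened intersection [C n] would have measure below [dl / 4]. For
    [V] the preimage of a small ball, [g V] can meet all the [U k] only when [g] brings the centre
    into [C n], which by unique ergodicity is too rare. *)
Lemma wms_pr_gt0 K (xs : 'I_K -> X) (U : 'I_K -> set X) :
  wms_tuple (R := R) act xs -> (forall k, open (U k) /\ U k (xs k)) ->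
  0 < pr nu (\bigcap_k (pi @` closure (U k))).
Proof.
move=> wx Ux; have [dl dl0 hdl] := wx U Ux.
pose D k := pi @` closure (U k).
rewrite lt_neqAle pr_ge0 andbT eq_sym; apply/eqP => D0.
pose C n := \bigcap_k closure (thick rho (D k) n.+1%:R^-1).
have cC n : closed (C n) by apply: closed_bigI => k _; exact: closed_closure.
have EC : \bigcap_n C n = \bigcap_k D k.
  rewrite /C -(eq_bigcapr (fun k _ => bigcap_closure_thick (@closed_pi_closure (U k)))).
  by apply/seteqP; split=> [y h k _ n _|y h n _ k _]; exact: h.
have [n|n y h k _|n] := @pr_lim R Y nu C (dl / 4) _ _ ltac:(by rewrite divr_gt0).
- by apply: closed_borel.
- by apply: (closureS (@thick_le _ _ rho _ _ _ (inv_natS_le n))); exact: h.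
rewrite EC D0 add0r => hn; set e : R := n.+1%:R^-1 in hn.
have e0 : 0 < e by rewrite invr_gt0.
have [x0 x0P] := pis point.
(* By invariance of [rho], the translates of this ball keep radius [e], the radius of the thickening
   in [C n]. *)
have oV : open (pi @^-1` mball rho point e).
  by apply: open_comp; [move=> x _; exact: pic|exact: open_mball].
have nV : (pi @^-1` mball rho point e) !=set0.
  by exists x0; rewrite /= x0P; exact: mball_center.
have := hdl _ oV nV; apply/negP; rewrite -leNgt; apply: upper_BD_le => F FP.
have := folner_frequency_le rY actYP actY_min rho_inv nu_inv FP point (cC n)
  (divr_gt0 dl0 (ltr0Sn R 3)).
apply: filterS => m hm; apply: (@le_trans _ _ (pr nu (C n) + dl / 4)); last first.
  by move: hn; rewrite -/(C n); lra.
apply: le_trans hm; rewrite /favg ler_pM2r ?invr_gt0 ?(folner_size_gt0 FP)//.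
apply: ler_sum => g _; apply: ind_sub => /= h k _.
have [_ [[x Vx <-] Ugx]] := h k; apply: subset_closure.
exists (pi (act g x)); first by exists (act g x) => //; exact: subset_closure.
by rewrite pie rho_inv metric_sym.
Qed.

Context (F : nat -> seq G).
Hypothesis FP : Folner_seq (R := R) F.

(** The number of visits has integral [pr nu D] times the length of [s], so its maximum is at least
    that. *)
Let visit_often (D : set Y) (s : seq G) : closed D ->
  exists y, pr nu D * (size s)%:R <= (count (fun g => `[< D (actY g y) >]) s)%:R :> R.
Proof.
move=> cD; pose N y := count (fun g => `[< D (actY g y) >]) s.
pose P n := `[< exists y, N y = n >].
have exP : exists n, P n by exists (N point); apply/asboolP; exists point.
have leP n : P n -> (n <= size s)%N by move=> /asboolP[y <-]; exact: count_size.
case: (ex_maxnP exP leP) => n /asboolP[y yn] maxn; exists y.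
rewrite -[leRHS]mulr1 -[X in _ <= _ * X](prT nu) -/(N y) yn.
have mD g : measurable (actY g @^-1` D : set (borel_type Y)).
  apply: closed_borel; apply: closed_comp => // x _; exact: (@act_continuous _ _ _ actYP).
have -> : pr nu D * (size s)%:R = \sum_(g <- s) pr nu (actY g @^-1` D).
  under eq_bigr do rewrite (pr_act nu_inv _ (closed_borel cD)).
  by rewrite big_const_seq count_predT iter_addr addr0 mulr_natr.
apply: sum_pr_le => // z; rewrite -countE ler_nat; apply: maxn.
by apply/asboolP; exists z.
Qed.

(* A point [y] visiting [D] often along [F n] is turned, by [fiber_family_return],
   into a translate [F n * t] along which [V] meets all the [U k] equally often. *)
Lemma upper_BD_ge_pr (K : nat) (C U : 'I_K -> set X) (V : set X) :
  (forall k, closed (C k)) -> (forall k, open (U k)) -> (forall k, C k `<=` U k) ->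
  open V -> V !=set0 ->
  ((pr nu (\bigcap_k (pi @` C k)))%:E <=
     upper_BD [set g : G | forall k, (act g @` V) `&` U k !=set0])%E.
Proof.
move=> cC oU CU oV nV; set D := \bigcap_k _; set H := mkset _.
have cD : closed D by apply: closed_bigI => k _; exact: (closed_factor_image dX Yhaus piF).
have [M [MP Minv _]] := folner_mean FP.
have [B [oB nB BV]] := factor_image_interior dX actP act_min actYP Yhaus piF oV nV.
have step n : exists t, pr nu D * (size (F n))%:R <=
    (count (fun g => `[< H (g * t)%g >]) (F n))%:R :> R.
  have [y hy] := visit_often (F n) cD.
  suff [t ht] : exists t, forall g, g \in F n -> D (actY g y) -> H (g * t)%g.
    exists t; apply: (le_trans hy); rewrite ler_nat.
    rewrite -!size_filter; apply: uniq_leq_size.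
      by rewrite filter_uniq//; case: (FP.1 n).
    move=> g; rewrite !mem_filter => /andP[/asboolP Dg gF]; rewrite gF andbT.
    by apply/asboolP; exact: ht.
  have [s sy] := minimal_orbit_dense actYP actY_min y oB nB.
  pose s' := [seq g <- F n | `[< D (actY g y) >]].
  pose gi (i : 'I_(size s')) := nth 1%g s' i.
  have Dgi i : D (actY (gi i) y).
    by have := mem_nth 1%g (ltn_ord i); rewrite mem_filter => /andP[/asboolP].
  (* Translating [u] by [s * (gi q.1)^-1] puts all these points over [actY s y], which lies in [B];
     one [h] then serves every visit and every [k]. *)
  have uP (q : 'I_(size s') * 'I_K) : exists u, C q.2 u /\ pi u = actY (gi q.1) y.
    by have [u Cu uy] := Dgi q.1 q.2 I; exists u.
  have [u hu] := choice uP.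
  have [||||||h hh] := @fiber_family_return R G X Y d act dY actY pi dX actP act_min piP
    M MP Minv _ (fun=> V) (fun q => act (gi q.1 * s^-1)%g @^-1` U q.2) (fun=> B)
    (fun q => act (s * (gi q.1)^-1)%g (u q)).
  - by [].
  - by [].
  - by [].
  - by move=> q; rewrite pie (hu q).2 -actM// -mulgA mulVg mulg1.
  - by move=> q; exact: open_act_preimage.
  - move=> q /=; rewrite -actM// mulgA -(mulgA _ s^-1%g) mulVg mulg1 mulgV act1//.
    by apply: CU; case: (hu q).
  exists (s^-1 * h)%g => g gF Dg k.
  have gs' : g \in s' by rewrite mem_filter gF andbT; apply/asboolP.
  have ig : (index g s' < size s')%N by rewrite index_mem.
  have [w Vw] := hh (Ordinal ig, k); rewrite /gi /= nth_index// => Uw.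
  exists (act (g * (s^-1 * h))%g w); split; first by exists w.
  by rewrite mulgA actM.
have [t ht] := choice step.
apply: (upper_BD_ge (folner_right_translate t FP)) => n.
rewrite favg_ind size_map ler_pdivlMr ?(folner_size_gt0 FP)// count_map.
exact: ht.
Qed.

Lemma fiber_wms_full_measure : exists Z : set Y, dense Z /\ G_delta Z /\ nu Z = 1%E /\
  forall y, Z y -> wms_set (R := R) act (pi @^-1` [set y]).
Proof.
have [_ [_ cX]] := dX; have [x0 _] := pis point.
have cP m : exists s : seq X, forall x, exists2 c, c \in s & mball d c m.+1%:R^-1 x.
  apply: (@compact_finite_subcover _ _ (fun c => mball d c m.+1%:R^-1)) => // [c|x].
    exact: open_mball.
  by exists x; apply: mball_center => //; rewrite invr_gt0.
have [cs csP] := choice cP.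
(* A countable base: balls of radius [1/(m+1)] around the finite nets [cs m], with [x0] as
   padding. *)
pose b (q : nat * nat) := mball d (nth x0 (cs q.1) q.2) q.1.+1%:R^-1.
have bP x (O : set X) : open O -> O x -> exists q, b q x /\ closure (b q) `<=` O.
  move=> oO Ox; have [e e0 eO] := open_mballP dT oO Ox.
  have [m me] := @inv_natS_lt R (e / 3) ltac:(by rewrite divr_gt0).
  have [c cc cx] := csP m x; exists (m, index c (cs m)).
  rewrite /b /= nth_index//; split=> // z /(closure_metricP dM dT) /(_ (e / 3)).
  case; first by rewrite divr_gt0.
  move=> z' cz' zz'; apply: eO.
  have := metric_triangle dM c x z; have := metric_triangle dM z' c z.
  rewrite (metric_sym dM x c) (metric_sym dM z' z); move: cx cz' zz' me.
  by rewrite /mball /=; set w := (_^-1); lra.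
pose D (s : seq (nat * nat)) := [set y | forall q, q \in s -> (pi @` closure (b q)) y].
have cD s : closed (D s).
  rewrite (_ : D s = \bigcap_(q in [set` s]) (pi @` closure (b q))).
    by apply: closed_bigI => q _; exact: closed_pi_closure.
  by apply/seteqP; split=> y h q; exact: h.
(* The finite lists of base indices are enumerated by [pickle]; [U n] removes [D s] exactly when it
   is null. *)
pose U n : set Y := if unpickle n is Some s then
  [set y | pr nu (D s) = 0 -> ~ D s y] else setT.
have UE s : pr nu (D s) = 0 -> [set y | pr nu (D s) = 0 -> ~ D s y] = ~` D s.
  by move=> D0; apply/seteqP; split=> y h; [exact: h|move=> _; exact: h].
have UT s : pr nu (D s) <> 0 -> [set y | pr nu (D s) = 0 -> ~ D s y] = setT.
  by move=> D0; apply/seteqP; split=> // y _ /D0.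
have oU n : open (U n).
  rewrite /U; case: unpickle => [s|]; last exact: openT.
  have [D0|D0] := pselect (pr nu (D s) = 0); last by rewrite UT//; exact: openT.
  by rewrite UE//; exact: closed_openC.
have nU n : nu.-negligible (~` U n : set (borel_type Y)).
  rewrite /U; case: unpickle => [s|]; last by rewrite setCT; exact: negligible_set0.
  have [D0|D0] := pselect (pr nu (D s) = 0); last by rewrite UT// setCT; exact: negligible_set0.
  rewrite UE// setCK; apply/negligibleP; first exact: closed_borel.
  by apply: eq_trans (prE nu (closed_borel (cD s))) _; rewrite D0.
have mZ : measurable (\bigcap_n U n : set (borel_type Y)).
  by apply: bigcap_measurable => [|n _]; [exists 0%N|exact: open_borel].
have Z1 : pr nu (\bigcap_n U n) = 1.
  have : pr nu (~` \bigcap_n U n) = 0.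
    rewrite /pr; suff -> : nu (~` \bigcap_n U n) = 0%E by [].
    apply/negligibleP; first exact: measurableC.
    by rewrite setC_bigcap; exact: negligible_bigcup.
  by rewrite prC//; lra.
exists (\bigcap_n U n); split.
  move=> O [y Oy] oO; apply: contrapT => OZ.
  have : pr nu O <= pr nu (~` \bigcap_n U n).
    apply: pr_le; [exact: open_borel|exact: measurableC|move=> z Oz Zz].
    by apply: OZ; exists z.
  rewrite prC// Z1 subrr leNgt => /negP; apply.
  by apply: (open_pr_gt0 rY actYP actY_min nu_inv) => //; exists y.
split; first by exists U.
split; first by rewrite prE// Z1.
move=> y Zy K xs xsy V Vx.
have [q hq] := choice (fun k => bP (xs k) (V k) (Vx k).1 (Vx k).2).
pose s := map q (enum 'I_K).
have DE : \bigcap_k (pi @` closure (b (q k))) = D s.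
  apply/seteqP; split=> [z h _ /mapP[k _ ->]|z h k _]; first exact: h.
  by apply: h; apply: map_f; rewrite mem_enum.
have Dy : D s y.
  rewrite -DE => k _; exists (xs k); last exact: xsy.
  by apply: subset_closure; case: (hq k).
have D0 : 0 < pr nu (D s).
  rewrite lt_neqAle pr_ge0 andbT eq_sym; apply/eqP => D0.
  by have := Zy (pickle s) I; rewrite /U pickleK => /(_ D0).
(* Half of the measure, since a strict inequality is required. *)
exists (pr nu (D s) / 2); first by rewrite divr_gt0.
move=> O oO nO; apply: (@lt_le_trans _ _ (pr nu (D s))%:E); first by rewrite lte_fin; lra.
rewrite -DE; apply: upper_BD_ge_pr => // k; first exact: closed_closure.
  by case: (Vx k).
by case: (hq k).
Qed.

(** * Counting points in the fibres *)

Lemma closure_mball_le x r z : closure (mball d x r) z -> d x z <= r.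
Proof.
move=> /(closure_metricP dM dT) h; rewrite leNgt; apply/negP => rz.
have [z' xz' zz'] := h (d x z - r) ltac:(lra).
have := metric_triangle dM z' x z; rewrite (metric_sym dM z' z).
by move: xz'; rewrite /mball /=; lra.
Qed.

Lemma separating_radius K (xs : 'I_K -> X) : exists2 r : R, 0 < r &
  forall k l, xs k <> xs l -> closure (mball d (xs k) r) `&` closure (mball d (xs l) r) = set0.
Proof.
have [||r r0 hr] := @common_radius R _ (enum {: 'I_K * 'I_K})
  (fun q r => xs q.1 <> xs q.2 -> r + r < d (xs q.1) (xs q.2)).
- by move=> q r r' rr' h /h; apply: le_lt_trans; rewrite lerD.
- move=> q _; have [E|E] := pselect (xs q.1 = xs q.2); first by exists 1.
  have q0 : 0 < d (xs q.1) (xs q.2).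
    rewrite lt_neqAle metric_ge0// andbT eq_sym; apply/eqP => /(metric_eq0 dM).
    exact: E.
  by exists (d (xs q.1) (xs q.2) / 4); [rewrite divr_gt0|move=> _; lra].
exists r => // k l kl; apply/seteqP; split=> // z [kz lz].
have := hr (k, l); rewrite mem_enum => /(_ isT kl) /=.
have := closure_mball_le kz; have := closure_mball_le lz.
have := metric_triangle dM z (xs k) (xs l); rewrite (metric_sym dM z (xs l)); lra.
Qed.

(** Two sets of full measure meet; over a common point, the [K] points of the fibre form the
    tuple. *)
Lemma essential_wms_tuple (K : nat) (Z : set Y) : regular_K_to_one pi nu K ->
  G_delta Z -> nu Z = 1%E ->
  (forall y, Z y -> wms_set (R := R) act (pi @^-1` [set y])) ->
  exists xs : 'I_K -> X, injective xs /\ wms_tuple (R := R) act xs.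
Proof.
move=> [mS S1] [U [oU ZE]] Z1 Zw; set S := mkset _ in mS S1.
have mZ : measurable (Z : set (borel_type Y)).
  by rewrite ZE; apply: bigcap_measurable => [|n _]; [exists 0%N|exact: open_borel].
have [y [Zy Sy]] : (Z `&` S) !=set0.
  apply: contrapT => ZS.
  have : pr nu Z <= pr nu (~` S).
    apply: pr_le => //; first exact: measurableC.
    by move=> y Zy Sy; apply: ZS; exists y.
  by rewrite prC// /pr Z1 S1 subrr ler10.
have /pcard_eqP[f] := Sy.
have fP (k : 'I_K) : exists x, pi x = y /\ f x = k.
  by have [x xy fx] := @surj _ _ _ _ f (nat_of_ord k) (ltn_ord k); exists x.
have [xs hxs] := choice fP; exists xs; split.
  by move=> k l kl; apply: val_inj; rewrite /= -(hxs k).2 -(hxs l).2 kl.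
by apply: (Zw y Zy) => k; exact: (hxs k).1.
Qed.

(** With disjoint closed neighbourhoods, each point of [D] has at least [K+1] preimages, so [D] is
    null, against [wms_pr_gt0]. *)
Lemma no_essential_wms_tuple (K : nat) : regular_K_to_one pi nu K ->
  ~ exists xs : 'I_K.+1 -> X, injective xs /\ wms_tuple (R := R) act xs.
Proof.
move=> [mS S1] [xs [xi wx]]; set S := mkset _ in mS S1.
have [r r0 hr] := separating_radius xs.
pose U k := mball d (xs k) r.
have hU k : open (U k) /\ U k (xs k) by split; [exact: open_mball|exact: mball_center].
have := wms_pr_gt0 wx hU; set D := \bigcap_k _; rewrite ltNge => /negP; apply.
have -> : 0 = pr nu (~` S) by rewrite prC// /pr S1 subrr.
have mD : measurable (D : set (borel_type Y)).
  by apply: closed_borel; exact: closed_pi_closures.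
apply: pr_le => // [|y Dy /pcard_eqP[f]]; first exact: measurableC.
have uP k : exists x, closure (U k) x /\ pi x = y.
  by have [x Ux xy] := Dy k I; exists x.
have [u hu] := choice uP.
have fK k : (f (u k) < K)%N by exact: (@funS _ _ _ _ f _ (hu k).2).
have : injective (fun k => Ordinal (fK k)).
  move=> k l /(congr1 val) /= fkl; apply: xi; apply: contrapT => kl.
  have ukl : u k = u l by apply: (@inj_hint _ _ _ f) => //; apply/mem_set; exact: (hu _).2.
  have := hr k l kl; move=> /seteqP[+ _] => /(_ (u k)); apply; split; first exact: (hu k).1.
  by rewrite ukl; exact: (hu l).1.
by move=> /leq_card; rewrite !card_ord ltnn.
Qed.


(** * Independence sets *)

Section independence_tree.
Context (M : (G -> R) -> R) (K : nat) (C U : 'I_K -> set X).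
Hypothesis MP : is_mean M.
Hypothesis Minv : forall g f, bnd f -> M (fun x => f (g * x)%g) = M f.
Hypothesis Mfreq : forall f c, bnd f ->
  (\forall n \near \oo, favg F f n <= c) -> M f <= c.
Hypotheses (cC : forall k, closed (C k)) (oU : forall k, open (U k)).
Hypothesis CU : forall k, C k `<=` U k.

Let D := \bigcap_k (pi @` C k).

Let cD : closed D.
Proof. by apply: closed_bigI => k _; exact: (closed_factor_image dX Yhaus piF). Qed.

Let visits (A : set Y) y : set G := [set g | A (actY g y)].

Lemma mean_visits_closed_le (A : set Y) y : closed A -> M (ind (visits A y)) <= pr nu A.
Proof.
move=> cA; apply/ler_addgt0Pr => e e0; apply: Mfreq => //.
exact: (folner_frequency_le rY actYP actY_min rho_inv nu_inv FP).
Qed.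

Lemma mean_visits_open_ge (A : set Y) y : open A -> pr nu A <= M (ind (visits A y)).
Proof.
move=> oA; have := mean_visits_closed_le y (open_closedC oA).
rewrite (prC _ (open_borel oA)) (_ : visits (~` A) y = ~` visits A y)//.
by rewrite (mean_indC MP) lerD2l lerN2.
Qed.

(** Indices are branches. The base point [y i] is interior to the image of [V i], and with frequency
    at least [a] all base points come close to [D] at the same time; [a] does not depend on the
    closeness [e]. *)
Definition it_family (I : finType) (V : I -> set X) (y : I -> Y) : Prop :=
  [/\ forall i, open (V i),
      forall i, exists2 e, 0 < e & mball rho (y i) e `<=` pi @` V i &
      exists2 a, 0 < a & forall e, 0 < e ->
        a <= M (ind [set g | forall i, thick rho D e (actY g (y i))])].

Lemma it_family_neq0 (I : finType) (V : I -> set X) (y : I -> Y) (i : I) :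
  it_family V y -> V i !=set0.
Proof.
move=> [_ /(_ i)[e e0 eV] _]; have [x Vx _] := eV _ (mball_center rM (y i) e0).
by exists x.
Qed.

(** A time good for [y] but bad for [y'] sends some [y' j] into a thin shell [B] around [D]. Each
    [j] thus costs at most the measure of the shell, which is closed so that the frequency bound
    applies. *)
Lemma it_family_mean_near (I J : finType) (f : J -> I) (y : I -> Y) (y' : J -> Y)
    (a e : R) : 0 < e ->
  (forall e, 0 < e -> a <= M (ind [set g | forall i, thick rho D e (actY g (y i))])) ->
  (forall j, rho (y (f j)) (y' j) < e) ->
  forall e', 0 < e' -> a - #|J|%:R * (pr nu (thick rho D (e + e + e)) - pr nu D) <=
    M (ind [set g | forall j, thick rho D e' (actY g (y' j))]).
Proof.
move=> e0 ha yy' e' e'0; pose e1 := Num.min e e'.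
have e10 : 0 < e1 by rewrite lt_min e0.
pose B := closure (thick rho D (e + e)) `\` thick rho D e1.
have cB : closed B.
  rewrite /B setDE; apply: closedI; first exact: closed_closure.
  by apply: open_closedC; exact: open_thick.
have prB : pr nu B <= pr nu (thick rho D (e + e + e)) - pr nu D.
  have mT : measurable (thick rho D (e + e + e) : set (borel_type Y)).
    by apply: open_borel; exact: open_thick.
  have mD : measurable (D : set (borel_type Y)) by exact: closed_borel.
  rewrite -prD//; last by apply: sub_thick => //; rewrite !addr_gt0.
  apply: pr_le; [exact: closed_borel|exact: measurableD|].
  move=> z [Tz nz]; split; first exact: (closure_thick rM rT e0).
  by move=> Dz; apply: nz; exact: sub_thick.
pose A' := [set g | forall j, thick rho D e' (actY g (y' j))].
have bS (j : J) : bnd (ind (visits B (y' j)) : G -> R) by [].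
have [bsum Msum] := mean_sum MP (enum J) bS.
have : a <= M (fun g => ind A' g + \sum_(j <- enum J) ind (visits B (y' j)) g).
  apply: (le_trans (ha e1 e10)); apply: (mean_le MP) => // [|g]; first exact: bnd_add.
  have sum0 : 0 <= \sum_(j <- enum J) ind (visits B (y' j)) g :> R.
    by apply: sumr_ge0 => j _; exact: ind_ge0.
  have [Ag|nAg] := pselect (A' g).
    by rewrite (indT Ag); apply: (le_trans (ind_le1 _ _)); rewrite lerDl.
  have [yg|nyg] := pselect (forall i, thick rho D e1 (actY g (y i))); last first.
    by rewrite indF// addr_ge0// ind_ge0.
  have [j nj] : exists j, ~ thick rho D e' (actY g (y' j)) by exact/existsNP.
  rewrite (indF nAg) add0r (big_rem j) ?mem_enum//= [X in _ <= X + _]indT.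
    by apply: (le_trans (ind_le1 _ _)); rewrite lerDl; apply: sumr_ge0 => i _; exact: ind_ge0.
  split; last by move/(thick_le (e' := e')) => h; apply: nj; apply: h; rewrite ge_min lexx orbT.
  apply: subset_closure; apply: (@thick_le _ _ _ _ (e1 + e)).
    by rewrite lerD2r ge_min lexx.
  by apply: (thick_shift rM (yg (f j))); rewrite rho_inv.
rewrite (meanD MP)// Msum => ha'; rewrite lerBlDr; apply: (le_trans ha'); rewrite lerD2l.
rewrite cardE mulr_natl -[size _]count_predT -iter_addr_0 -big_const_seq.
by apply: ler_sum => j _; apply: le_trans prB; exact: mean_visits_closed_le.
Qed.

Lemma it_family_step (I : finType) (V : I -> set X) (y : I -> Y) : it_family V y ->
  exists g (V' : I * 'I_K -> set X) (y' : I * 'I_K -> Y), it_family V' y' /\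
    forall q, V' q `<=` V q.1 `&` act g @^-1` U q.2.
Proof.
move=> [oV yV [a a0 ha]]; pose J := (I * 'I_K)%type.
(* Chosen so that the shells of all new branches together cost at most [a / 2]; the [+ 1] avoids a
   zero denominator. *)
have c0 : 0 < a / (2 * (#|{: J}|%:R + 1)).
  by rewrite divr_gt0// mulr_gt0// ltr_wpDl.
have [e3 e30 he3] := pr_thick rY nu cD c0.
have [||ev ev0 hev] := @common_radius R _ (enum I)
  (fun i e => mball rho (y i) e `<=` pi @` V i).
- by move=> i e e' ee' h; apply: subset_trans h => x /= /lt_le_trans; apply.
- by move=> i _; exact: yV.
(* A third of [e3], as the shell estimate involves [e + e + e]. *)
pose e := Num.min ev (e3 / 3).
have e0 : 0 < e by rewrite lt_min ev0 divr_gt0.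
have [g0 hg0] := mean_ind_gt0 MP (lt_le_trans a0 (ha e e0)).
(* At time [g0] every base point is near [D], over which each [C k] has a point; pulling it back by
   [g0] gives a target for each new branch. *)
have pP (q : J) : exists p, U q.2 (act g0 p) /\ mball rho (y q.1) e (pi p).
  have [z Dz zy] := hg0 q.1; have [u Cu uz] := Dz q.2 Logic.I.
  exists (act g0^-1%g u); rewrite actVK//; split; first exact: CU.
  by rewrite /mball /= pie uz -(rho_inv g0) actVK// metric_sym.
have [p hp] := choice pP.
(* The restriction keeps the new base points within [e] of the old ones. *)
pose W (q : J) := V q.1 `&` pi @^-1` mball rho (y q.1) e.
have oW q : open (W q).
  by apply: openI => //; apply: open_comp; [move=> x _; exact: pic|exact: open_mball].
have BW q : mball rho (y q.1) e `<=` pi @` W q.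
  move=> z ze; have [||x Vx xz] := hev q.1 _ z; first by rewrite mem_enum.
    by apply: (lt_le_trans ze); rewrite ge_min lexx.
  by exists x => //; split=> //; rewrite /= xz.
have [||||||h hh] := @fiber_family_return R G X Y d act dY actY pi dX actP act_min piP
  M MP Minv _ W (fun q => act g0 @^-1` U q.2) (fun q => mball rho (y q.1) e) p.
- exact: oW.
- by move=> q; exact: open_mball.
- exact: BW.
- by move=> q; case: (hp q).
- by move=> q; exact: open_act_preimage.
- by move=> q; case: (hp q).
pose g := (g0 * h)%g; pose V' q := W q `&` act g @^-1` U q.2.
have oV' q : open (V' q) by apply: openI => //; exact: open_act_preimage.
have nV' q : V' q !=set0.
  by have [w Ww Uw] := hh q; exists w; split=> //; rewrite /g /= actM.
have y'P q : exists z, exists2 r : R, 0 < r & mball rho z r `<=` pi @` V' q.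
  have [B [oB [z Bz] BV]] :=
    factor_image_interior dX actP act_min actYP Yhaus piF (oV' q) (nV' q).
  have [r r0 rB] := open_mballP rT oB Bz.
  by exists z, r => //; exact: subset_trans BV.
have [y' hy'] := choice y'P.
have yy' q : rho (y q.1) (y' q) < e.
  have [r r0 hr] := hy' q; have [x [[_ xe] _] xy] := hr _ (mball_center rM (y' q) r0).
  by rewrite -xy.
exists g, V', y'; split; last by move=> q x [[Vx _] Ux].
split=> //; exists (a / 2) => [|e' e'0]; first by rewrite divr_gt0.
apply: le_trans (it_family_mean_near e0 ha yy' e'0).
set n : R := #|_|%:R; have n0 : 0 <= n by rewrite /n.
set t := pr nu _ - _.
have ht : t <= a / (2 * (n + 1)).
  rewrite /t lerBlDl; apply: le_trans (ltW he3); apply: pr_le.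
  - by apply: open_borel; exact: open_thick.
  - by apply: open_borel; exact: open_thick.
  - apply: thick_le; have : e <= e3 / 3 by rewrite ge_min lexx orbT.
    lra.
have : n * t <= n * (a / (2 * (n + 1))) by exact: ler_wpM2l.
have : n * (a / (2 * (n + 1))) <= a / 2.
  rewrite mulrCA ler_pM2l// ler_pdivrMr ?mulr_gt0 ?ltr_wpDl//; lra.
lra.
Qed.

(* The list [l] of group elements chosen so far, with one nonempty open set for each
   choice of targets along [l]. *)
Let it_list (l : seq G) : Prop := exists (I : finType) (V : I -> set X) (y : I -> Y),
  it_family V y /\ forall s : G -> 'I_K, exists i,
    forall g, g \in l -> V i `<=` act g @^-1` U (s g).

(** The new [g] is not in [l]: otherwise the branch with constant target [k0], refined by [l0],
    would send a point into both disjoint sets. *)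
Let it_list_cons (k0 l0 : 'I_K) (l : seq G) : U k0 `&` U l0 = set0 -> it_list l ->
  exists g, g \notin l /\ it_list (g :: l).
Proof.
move=> dkl [I [V [y [gV path]]]].
have [g [V' [y' [gV' sV']]]] := it_family_step gV; exists g; split.
  apply/negP => gl; have [i hi] := path (fun=> k0).
  have [x V'x] := it_family_neq0 (i, l0) gV'; have [Vx Ux] := sV' _ _ V'x.
  suff : (U k0 `&` U l0) (act g x) by rewrite dkl.
  by split=> //; exact: (hi g gl).
exists (I * 'I_K)%type, V', y'; split=> // s; have [i hi] := path s.
exists (i, s g) => g'; rewrite inE => /orP[/eqP-> x /sV'[]//|g'l x /sV'[Vx _]].
exact: (hi g').
Qed.

Lemma infinite_independence_set (k0 l0 : 'I_K) : U k0 `&` U l0 = set0 -> 0 < pr nu D ->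
  exists J : set G, infinite_set J /\ independence_set act U J.
Proof.
move=> dkl D0.
have P0 : it_list [::].
  (* The root is a single branch with no constraint; its frequency is at least the measure of
     [D]. *)
  exists unit, (fun=> setT), (fun=> point); split; last by move=> s; exists tt.
  split=> [_|_|]; first exact: openT.
    by exists 1 => // y _; have [x xy] := pis y; exists x.
  exists (pr nu D) => // e e0; have mT := open_borel (open_thick rM rT D e).
  apply: (@le_trans _ _ (pr nu (thick rho D e))).
    by apply: pr_le => //; [exact: closed_borel|exact: sub_thick].
  apply: (le_trans (mean_visits_open_ge point (open_thick rM rT D e))).
  by apply: mean_ind_le => // g ? ?.
have nxP l : exists g, it_list l -> g \notin l /\ it_list (g :: l).
  have [Pl|nPl] := pselect (it_list l); last by exists 1%g => /nPl.
  by have [g hg] := it_list_cons dkl Pl; exists g.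
have [nx hnx] := choice nxP.
pose ls n := iter n (fun l => nx l :: l) [::].
have lsP n : it_list (ls n) by elim: n => //= n IH; case: (hnx _ IH).
have ls_uniq n : uniq (ls n).
  by elim: n => //= n IH; rewrite IH andbT; case: (hnx _ (lsP n)).
have ls_size n : size (ls n) = n by elim: n => //= n ->.
have ls_mono m n : (m <= n)%N -> {subset ls m <= ls n}.
  elim: n => [|n IH]; first by rewrite leqn0 => /eqP->.
  rewrite leq_eqVlt ltnS => /orP[/eqP-> //|/IH h g /h]; rewrite inE => ->.
  by rewrite orbT.
exists [set g | exists n, g \in ls n]; split.
  move=> /finite_seqP[s sE].
  have sub : {subset ls (size s).+1 <= s}.
    by move=> g gl; have : [set` s] g by rewrite -sE; exists (size s).+1.
  by have := uniq_leq_size (ls_uniq (size s).+1) sub; rewrite ls_size ltnn.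
move=> I sigma _ IJ.
have [n hn] : exists n, {subset I <= ls n}.
  elim: I IJ => [|g I IH] IJ; first by exists 0%N.
  have [|n hn] := IH; first by move=> g' g'I; apply: IJ; rewrite inE g'I orbT.
  have [|m gm] := IJ g; first by rewrite inE eqxx.
  exists (maxn m n) => g'; rewrite inE => /orP[/eqP->|/hn].
    exact: (ls_mono m _ (leq_maxl _ _)).
  exact: (ls_mono n _ (leq_maxr _ _)).
have [J [V [y [gV path]]]] := lsP n; have [i hi] := path sigma.
have [x Vx] := it_family_neq0 i gV.
by exists x => g gI; exact: (hi g (hn g gI)).
Qed.

End independence_tree.

(** By syndeticity every [g] is [h^-1 * j] with [h] in a finite list and [j] a return time; finitely
    many return times would make [G] finite. *)
Lemma infinite_return_set (O : set X) x : infinite_set [set: G] -> open O -> O !=set0 ->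
  infinite_set [set g | O (act g x)].
Proof.
move=> Ginf oO nO /finite_seqP[t tE]; have [_ [_ cX]] := dX.
have [s hs] := minimal_syndetic actP act_min cX oO nO; apply: Ginf.
apply: (@sub_finite_set _ _ [set` [seq (h^-1 * j)%g | h <- s, j <- t]]) => // g _.
have [h hs_ Oh] := hs (act g x); apply/allpairsP; exists (h, (h * g)%g); split=> //=.
  by have : [set` t] (h * g)%g by rewrite -tE /= actM.
by rewrite mulgA mulVg mul1g.
Qed.

Lemma wms_IT_tuple K (xs : 'I_K -> X) : infinite_set [set: G] ->
  wms_tuple (R := R) act xs -> IT_tuple act xs.
Proof.
move=> Ginf wx U hU.
have [r r0 hr] := separating_radius xs.
pose U' k := U k `&` mball d (xs k) r.
have hU' k : open (U' k) /\ U' k (xs k).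
  have [hUk Uk] := hU k; split; last by split=> //; exact: mball_center.
  by apply: openI => //; exact: open_mball.
have [||e e0 he] := @common_radius R _ (enum 'I_K) (fun k e => mball d (xs k) e `<=` U' k).
- by move=> k e e' ee' h; apply: subset_trans h => x /= /lt_le_trans; apply.
- by move=> k _; have [h1 h2] := hU' k; exact: (open_mballP dT h1 h2).
have {}he k : mball d (xs k) e `<=` U' k by apply: he; rewrite mem_enum.
(* Two distinct entries give disjoint targets, which force new group elements in the tree; a
   constant tuple is treated by return times. *)
have [[k [k' kl]]|alleq] := pselect (exists k l, xs k <> xs l).
  pose B k := mball d (xs k) (e / 2).
  have [M [MP Minv Mfreq]] := folner_mean FP.
  have BU j : closure (B j) `<=` U' j.
    by move=> x /closure_mball_le h; apply: he; rewrite /mball /=; lra.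
  have disj : U' k `&` U' k' = set0.
    apply/seteqP; split=> // x [[_ xk] [_ xl]].
    by have /seteqP[+ _] := hr _ _ kl => /(_ x); apply; split; exact: subset_closure.
  have [||J [infJ indJ]] := infinite_independence_set MP Minv Mfreq
    (fun j => @closed_closure _ (B j)) _ BU disj.
  - by move=> j; case: (hU' j).
  - apply: (wms_pr_gt0 wx) => j; split; first exact: open_mball.
    by apply: mball_center => //; rewrite divr_gt0.
  exists J; split=> // I s I0 IJ; have [x hx] := indJ I s I0 IJ.
  by exists x => g /hx[].
have eqx k l : xs k = xs l by apply: contrapT => kl; apply: alleq; exists k, l.
have [k0 _|noK] := pickP 'I_K; last first.
  by exists setT; split=> // I s _ _; have := noK (s 1%g).
exists [set g | mball d (xs k0) e (act g (xs k0))]; split.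
  apply: infinite_return_set => //; first exact: open_mball.
  by exists (xs k0); exact: mball_center.
move=> I s _ IJ; exists (xs k0) => g /IJ /=; rewrite (eqx k0 (s g)) => /he[].
by [].
Qed.

End weakly_mean_sensitive.

Theorem theorem1p6
  (R : realType)
  (G : groupType) (hGcount : countable [set: G]) (hGinf : infinite_set [set: G])
  (hGamen : amenable_group R G)
  (X : topologicalType) (d : X -> X -> R) (act : G -> X -> X)
  (hX : compact_metric_space d) (hact : is_action act)
  (hmin : minimal_system act) (hBron : local_Bronstein d act)
  (Y : ptopologicalType) (dY : Y -> Y -> R) (actY : G -> Y -> Y) (pi : X -> Y)
  (hpi : max_equicontinuous_factor act dY actY pi)
  (nu : probability (borel_type Y) R)
  (hnu : forall (g : G) (A : set (borel_type Y)),
           measurable A -> nu (actY g @^-1` A) = nu A) :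
  (* (i) *)
  (exists Z : set Y, dense Z /\ G_delta Z /\ nu Z = 1%E /\
     forall y, Z y -> wms_set (R := R) act (pi @^-1` [set y])) /\
  (* (ii) *)
  (forall K : nat, (0 < K)%N -> regular_K_to_one pi nu K ->
     (exists xs : 'I_K -> X, injective xs /\ wms_tuple (R := R) act xs) /\
     ~ (exists xs : 'I_K.+1 -> X, injective xs /\ wms_tuple (R := R) act xs)) /\
  (* (iii) *)
  (forall A : set X, A !=set0 -> wms_set (R := R) act A -> IT_set act A).
Proof.
have [F FP] := hGamen.
have [dYc [aY [eY _]]] := hpi.
(* An invariant metric makes balls around points of one orbit congruent, as the frequency bound
   requires. *)
have [rho rY rho_inv] := equicontinuous_invariant_metric dYc aY eY.
have hi := fiber_wms_full_measure hX hact hmin hpi rY hnu FP.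
split=> //; split=> [K _ hK|A nA wA].
  have [Z [_ [gZ [Z1 Zw]]]] := hi; split.
    exact: (essential_wms_tuple hK gZ Z1 Zw).
  exact: (no_essential_wms_tuple hX hmin hpi rY rho_inv hnu hK).
split=> // K xs xsA.
by apply: (wms_IT_tuple hX hact hmin hpi rY rho_inv hnu FP hGinf); exact: wA.
Qed.
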